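(* For every oriented graph $G$, the integral $I_G(1)$ is absolutely convergent. For all $X\in\mathcal{GC}_3$ one has $I_X(1)=\langle X,\mathfrak m\rangle$, where $$\mathfrak m=\sum_{i=1}^\infty\frac{D_{2i+1}}{2\cdot(2i+1)!}\in\mathsf{GC}_3.$$
   Context: **Graph complex.** A graph $G$ consists of finite sets of vertices $V(G)$, edges $E(G)$ and half-edges; each edge $e$ consists of two half-edges $H(e)=\{e',e''\}$, each incident to a vertex (multiple edges, self-loops allowed). With $\det M=\bigwedge^{\mathrm{rk}M}M$, an orientation is a generator of $\det\mathbb Z^{V(G)}\otimes\bigotimes_e\det\mathbb Z^{H(e)}$ (vertex order and edge directions, up to sign; $o_e=e'\wedge e''$ directs $e$ from the endpoint of $e'$ to that of $e''$). $\mathcal{GC}_3$ is the $\mathbb Q$-span of oriented connected graphs with all valencies $\ge3$, modulo $(G,o)\sim(G',\varphi_*o)$ for isomorphisms $\varphi$ and $(G,-o)\sim-(G,o)$, bigraded by loop number $\ell=|E|-|V|+1$ and degree $|E|-3\ell$. $\mathsf{GC}_3$ is its completion (product over bidegrees). The pairing between $\mathcal{GC}_3$ and $\mathsf{GC}_3$ is $\langle G,G'\rangle=\pm|\mathrm{Aut}\,G|$ if $G\sim\pm G'\not\sim0$, and $0$ otherwise, where $\mathrm{Aut}\,G$ is the automorphism group of the unoriented half-edge graph. The dipole $D_m$ has two vertices ordered $0<1$ and $m$ edges directed from $0$ to $1$. **Integrals.** For connected $G$ with $m$ edges, orientations are identified with generators of $\det\mathbb Z^{E(G)}\otimes\det H_1(G)$: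 $v_1\wedge\dots\wedge v_n\otimes\bigotimes_eo_e$ corresponds to $(\det A)\,e_1\wedge\dots\wedge e_m\otimes C_1\wedge\dots\wedge C_\ell$, where $A\in\mathrm{GL}_m(\mathbb Z)$ has columns $C_1,\dots,C_\ell,P_2,\dots,P_n$ in the basis $o_{e_1},\dots,o_{e_m}$ of 1-chains and $P_i$ is a 1-chain with boundary $v_i-v_1$ (head minus tail). Given $o=e_1\wedge\dots\wedge e_m\otimes C_1\wedge\dots\wedge C_\ell$ with $\mathcal C=(C_1,\dots,C_\ell)$ a basis of $H_1(G)\subset\mathbb Z^m$ (an $m\times\ell$ matrix), put $\Lambda_{\mathcal C}(x)=\mathcal C^T\mathrm{diag}(x_1,\dots,x_m)\mathcal C$ and $$I_{(G,o)}(1)=\frac1{(-2\pi)^{\ell/2}}\int_{\sigma_G}\phi_G,$$ where $\sigma_G=\{[x_1:\dots:x_m]:x_i>0\}$ is oriented by $\sum_i(-1)^{i-1}x_i\,dx_1\wedge\cdots\widehat{dx_i}\cdots\wedge dx_m$, and $\phi_G$ is the pullback along $\Lambda_{\mathcal C}$ of the $\ell$-form $\phi^\ell=\mathrm{Pf}(dX\,X^{-1}dX)/\sqrt{\det X}$ (Pfaffian) on positive definite symmetric $\ell\times\ell$ matrices $X$, with $\phi^\ell=0$ for $\ell$ odd. By convention the integral is $0$ if $\ell\ne m-1$. $I_X(1)$ is extended linearly to $X\in\mathcal{GC}_3$. *)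

(* Defs.v *)
From HB Require Import structures.
From mathcomp Require Import all_boot all_order all_algebra all_fingroup.
From mathcomp Require Import all_classical all_reals all_analysis.
From mathcomp Require Import freeg zify.

Set Implicit Arguments.
Unset Strict Implicit.
Unset Printing Implicit Defensive.

Import Order.TTheory GRing.Theory Num.Theory.
Local Open Scope ring_scope.
Local Open Scope quotient_scope.

(* Graphs are given by half-edges; multiple edges and self-loops are allowed. *)
Record hgraph (V E H : finType) := HGraph {
  edge_of : H -> E;
  inc : H -> V;
  edge_of_card : forall e, #|[set h | edge_of h == e]| = 2
}.

Section Graphs.
Variables (V E H : finType) (G : hgraph V E H).

Definition adj : rel V := fun v w =>
  [exists h, exists h',
    [&& edge_of G h == edge_of G h', inc G h == v & inc G h' == w]].

Definition gconnected : bool :=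
  (0 < #|V|)%N && [forall v, forall w, connect adj v w].

(* A self-loop contributes 2. *)
Definition valency (v : V) : nat := #|[set h | inc G h == v]|.

Definition valency_ge3 : bool := [forall v, (3 <= valency v)%N].

(* The total orders v_1 < ... < v_n on the vertices are encoded by the
   permutations s of V: v is at position [vpos s v] (counted from 0).  For V =
   'I_n, the identity is the usual order. *)
Definition vpos (s : {perm V}) (v : V) : 'I_#|V| := enum_rank (s v).

(* A direction o_e = e' /\ e'' for each edge e, encoded by the tails e'. *)
Record directions := Directions {
  tail :> E -> H;
  tailP : forall e, edge_of G (tail e) = e
}.

Definition flips (d d' : directions) : nat := #|[set e | d e != d' e]|.

(* A generator o of the rank one module det Z^V (x) (x)_e det Z^H(e), given by
   its coordinate [ori s d] = +1 or -1 relative to each of the generators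
   v_1 /\ ... /\ v_n (x) (x)_e o_e; [ori_change] is how these generators are
   related to each other. *)
Record orientation := Orientation {
  ori :> {perm V} -> directions -> int;
  ori_unit : forall s d, ori s d * ori s d = 1;
  ori_change : forall s s' d d',
    ori s' d' = (-1) ^+ (odd_perm s + odd_perm s' + flips d d')%N * ori s d
}.

Lemma opp_ori_unit (o : orientation) s d : - o s d * - o s d = 1.
Proof. by rewrite mulrNN ori_unit. Qed.

Lemma opp_ori_change (o : orientation) s s' d d' :
  - o s' d' =
  (-1) ^+ (odd_perm s + odd_perm s' + flips d d')%N * - o s d.
Proof. by rewrite (ori_change o s s' d d') mulrN. Qed.

Definition opp_orientation (o : orientation) : orientation :=
  Orientation (opp_ori_unit o) (opp_ori_change o).

Lemma flips_sign (d1 d2 d3 : directions) :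
  (-1) ^+ flips d1 d3 = (-1) ^+ flips d1 d2 * (-1) ^+ flips d2 d3 :> int.
Proof.
have signE (d d' : directions) :
    (-1) ^+ flips d d' = \prod_e (-1) ^+ (d e != d' e) :> int.
  rewrite /flips -sum1_card -prodrXr /= big_mkcond /=.
  by apply: eq_bigr => e _; rewrite inE; case: (d e != d' e).
rewrite !signE -big_split; apply: eq_bigr => e _ /=.
have [->|n12] := eqVneq (d1 e) (d2 e); first by rewrite mul1r.
have [<-|n23] := eqVneq (d2 e) (d3 e); first by rewrite n12 mulr1.
suff -> : d1 e = d3 e by rewrite eqxx.
apply/eqP; apply: contraT => n13.
have: (#|[set d1 e; d2 e; d3 e]| <= #|[set h | edge_of G h == e]|)%N.
  apply: subset_leq_card; apply/fintype.subsetP => h; rewrite !inE.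
  by case/orP => [/orP[]|] /eqP->; rewrite tailP.
rewrite edge_of_card finset.setUC cardsU1 !inE cards2 negb_or.
by rewrite eq_sym n13 eq_sym n23 n12.
Qed.

(* The orientation v_1 /\ ... /\ v_n (x) (x)_e o_e. *)
Section StdOrientation.
Variables (s0 : {perm V}) (d0 : directions).

Definition std_ori (s : {perm V}) (d : directions) : int :=
  (-1) ^+ (odd_perm s0 + odd_perm s + flips d0 d)%N.

Lemma std_ori_unit s d : std_ori s d * std_ori s d = 1.
Proof. by rewrite /std_ori -expr2 sqrr_sign. Qed.

Lemma std_ori_change s s' d d' : std_ori s' d' =
  (-1) ^+ (odd_perm s + odd_perm s' + flips d d')%N * std_ori s d.
Proof.
rewrite /std_ori !exprD (flips_sign d0 d d').
set a := (-1) ^+ flips d0 d; set b := (-1) ^+ flips d d'.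
by case: (odd_perm s0); case: (odd_perm s); case: (odd_perm s');
  rewrite !(expr0, expr1, mul1r, mulN1r, mulrN, mulNr, opprK) // mulrC.
Qed.

Definition std_orientation : orientation :=
  Orientation std_ori_unit std_ori_change.
End StdOrientation.

Definition is_aut (t : {perm V} * {perm E} * {perm H}) : bool :=
  [forall h, (edge_of G (t.2 h) == t.1.2 (edge_of G h)) &&
             (inc G (t.2 h) == t.1.1 (inc G h))].

Definition card_aut : nat := #|[set t | is_aut t]|.

End Graphs.

Section Isomorphisms.
Variables (V E H V' E' H' : finType).
Variables (G : hgraph V E H) (G' : hgraph V' E' H').

Record giso := GIso {
  iso_v : V -> V';
  iso_e : E -> E';
  iso_h : H -> H';
  iso_v_bij : bijective iso_v;
  iso_e_bij : bijective iso_e;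
  iso_h_bij : bijective iso_h;
  iso_edge_of : forall h, edge_of G' (iso_h h) = iso_e (edge_of G h);
  iso_inc : forall h, inc G' (iso_h h) = iso_v (inc G h)
}.

(* o' is the push-forward phi_* o. *)
Definition is_push (phi : giso) (o : orientation G) (o' : orientation G') :=
  forall (s : {perm V}) (s' : {perm V'}) (d : directions G)
    (d' : directions G'),
  (forall v, vpos s' (iso_v phi v) = vpos s v :> nat) ->
  (forall e, d' (iso_e phi e) = iso_h phi (d e)) ->
  o' s' d' = o s d.

End Isomorphisms.

(* Oriented graphs generating GC_3.  Up to isomorphism, the finite sets of
   vertices, edges and half-edges may be taken to be ordinals. *)
Record ograph := OGraph {
  nv : nat; ne : nat; nh : nat;
  ugraph : hgraph 'I_nv 'I_ne 'I_nh;
  ograph_connected : gconnected ugraph;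
  ograph_valency : valency_ge3 ugraph;
  ograph_ori : orientation ugraph
}.

HB.instance Definition _ := gen_eqMixin ograph.
HB.instance Definition _ := gen_choiceMixin ograph.

Definition opp_ograph (g : ograph) : ograph :=
  OGraph (ograph_connected g) (ograph_valency g)
    (opp_orientation (ograph_ori g)).

Definition loops (g : ograph) : int := (ne g)%:Z - (nv g)%:Z + 1.

Definition bidegree (g : ograph) : int * int :=
  (loops g, (ne g)%:Z - 3 * loops g).

(* The Q-linear span of the relations (G, o) ~ (G', phi_* o) and
   (G, - o) ~ - (G, o). *)
Inductive gc_null : {freeg ograph / rat} -> Prop :=
| gc_null0 : gc_null 0
| gc_nullD (q : rat) (x y : {freeg ograph / rat}) :
    gc_null x -> gc_null y -> gc_null (q *: x + y)
| gc_null_iso (g g' : ograph) (phi : giso (ugraph g) (ugraph g')) :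
    is_push phi (ograph_ori g) (ograph_ori g') ->
    gc_null (<< g >> - << g' >>)
| gc_null_opp (g : ograph) : gc_null (<< opp_ograph g >> + << g >>).

Definition gc_nullb : {pred {freeg ograph / rat}} := fun x => `[< gc_null x >].

Lemma gc_nullZ (q : rat) x : gc_null x -> gc_null (q *: x).
Proof.
by move=> nx; rewrite -[_ *: _]addr0; apply: gc_nullD => //; constructor.
Qed.

Lemma gc_nullb_zmod : zmod_closed gc_nullb.
Proof.
split; first by apply/asboolP; constructor.
move=> x y /asboolP nx /asboolP ny; apply/asboolP.
by rewrite -[x]scale1r; apply: gc_nullD => //; rewrite -scaleN1r;
  exact: gc_nullZ.
Qed.

HB.instance Definition _ :=
  GRing.isZmodClosed.Build {freeg ograph / rat} gc_nullb gc_nullb_zmod.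

Definition GC3 := @Quotient.quot {freeg ograph / rat} gc_nullb.

HB.instance Definition _ := Choice.on GC3.
HB.instance Definition _ := Quotient.on GC3.
HB.instance Definition _ := GRing.Zmodule.on GC3.

Definition gc_pi (x : {freeg ograph / rat}) : GC3 := \pi_GC3 x.

Lemma gc_piE x y : gc_pi x = gc_pi y <-> gc_null (x - y).
Proof.
split=> [/eqP|n]; last first.
  by apply/eqP; rewrite -Quotient.idealrBE; apply/asboolP.
by rewrite -Quotient.idealrBE => /asboolP.
Qed.

Definition gc_scale (q : rat) (X : GC3) : GC3 :=
  gc_pi (q *: generic_quotient.repr X).

Lemma gc_piK X : gc_pi (generic_quotient.repr X) = X. Proof. exact: reprK. Qed.

Lemma gc_piD x y : gc_pi (x + y) = gc_pi x + gc_pi y.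
Proof. exact: (raddfD (\pi_GC3)). Qed.

Lemma gc_piZ_subproof q x : gc_scale q (gc_pi x) = gc_pi (q *: x).
Proof.
by apply/gc_piE; rewrite -scalerBr; apply/gc_nullZ/gc_piE/gc_piK.
Qed.

Lemma gc_scaleA a b X : gc_scale a (gc_scale b X) = gc_scale (a * b) X.
Proof. by rewrite -[X]gc_piK !gc_piZ_subproof scalerA. Qed.

Lemma gc_scale1 : left_id 1 gc_scale.
Proof. by move=> X; rewrite -[X]gc_piK gc_piZ_subproof scale1r. Qed.

Lemma gc_scaleDr : right_distributive gc_scale +%R.
Proof.
move=> a X Y; rewrite -[X]gc_piK -[Y]gc_piK -gc_piD !gc_piZ_subproof.
by rewrite scalerDr gc_piD.
Qed.

Lemma gc_scaleDl X : {morph gc_scale^~ X : a b / a + b}.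
Proof.
by move=> a b; rewrite -[X]gc_piK !gc_piZ_subproof scalerDl gc_piD.
Qed.

HB.instance Definition _ := GRing.Zmodule_isLmodule.Build rat GC3
  gc_scaleA gc_scale1 gc_scaleDr gc_scaleDl.

Lemma gc_piZ q x : gc_pi (q *: x) = q *: gc_pi x.
Proof. by rewrite -gc_piZ_subproof. Qed.

Definition gc_class (g : ograph) : GC3 := gc_pi << g >>.

Lemma gc_class_iso (g g' : ograph) (phi : giso (ugraph g) (ugraph g')) :
  is_push phi (ograph_ori g) (ograph_ori g') -> gc_class g = gc_class g'.
Proof. by move=> pu; apply/gc_piE/(gc_null_iso pu). Qed.

Lemma gc_class_opp g : gc_class (opp_ograph g) = - gc_class g.
Proof.
apply/eqP; rewrite -addr_eq0 /gc_class -gc_piD; apply/eqP.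
rewrite (_ : 0 = gc_pi 0); last first.
  by rewrite -(scale0r (0 : {freeg ograph / rat})) gc_piZ scale0r.
by apply/gc_piE; rewrite subr0; exact: gc_null_opp.
Qed.

(* The linear extension to GC_3 of a function of oriented graphs that is
   compatible with the relations; see [gc_extP] and [gc_ext_linear]. *)
Definition gc_ext (f : ograph -> rat) (X : GC3) : rat :=
  fglift (f : ograph -> rat^o) (generic_quotient.repr X).

Definition gc_compat (f : ograph -> rat) : Prop :=
  (forall (g g' : ograph) (phi : giso (ugraph g) (ugraph g')),
     is_push phi (ograph_ori g) (ograph_ori g') -> f g = f g') /\
  (forall g, f (opp_ograph g) = - f g).

Lemma fglift_linear (f : ograph -> rat) q x y :
  fglift (f : ograph -> rat^o) (q *: x + y) =
  q * fglift (f : ograph -> rat^o) x + fglift (f : ograph -> rat^o) y.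
Proof.
pose F : {freeg ograph / rat} -> rat := fglift (f : ograph -> rat^o).
have FB u v : F (u - v) = F u - F v by exact: (@lift_is_additive rat ograph rat^o f).
have F0 : F 0 = 0 by rewrite -{1}(subrr 0) FB subrr.
have FN u : F (- u) = - F u by rewrite -sub0r FB F0 sub0r.
have FD u v : F (u + v) = F u + F v by rewrite -[v]opprK FB FN !opprK.
rewrite -/(F _) -/(F x) -/(F y) FD; congr (_ + _).
rewrite -{2}[x]freeg_sumE (_ : q *: x = fgscale q x)// /fgscale.
rewrite !(big_morph F FD F0) mulr_sumr; apply: eq_bigr => g _.
by rewrite /F !liftU; exact: (esym (mulrA _ _ _)).
Qed.

Lemma fgliftD (f : ograph -> rat) x y :
  fglift (f : ograph -> rat^o) (x + y) =
  fglift (f : ograph -> rat^o) x + fglift (f : ograph -> rat^o) y.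
Proof. by rewrite -{1}[x]scale1r fglift_linear mul1r. Qed.

Lemma fgliftB (f : ograph -> rat) x y :
  fglift (f : ograph -> rat^o) (x - y) =
  fglift (f : ograph -> rat^o) x - fglift (f : ograph -> rat^o) y.
Proof.
rewrite -(scaleN1r y) [X in fglift _ X]addrC fglift_linear mulN1r; exact: addrC.
Qed.

Lemma fglift0 (f : ograph -> rat) : fglift (f : ograph -> rat^o) 0 = 0.
Proof. by rewrite -{1}(subrr 0) fgliftB subrr. Qed.

Section Extension.
Variables (f : ograph -> rat) (fc : gc_compat f).
Local Notation F := (fglift (f : ograph -> rat^o)).

Lemma fglift_null x : gc_null x -> F x = 0.
Proof.
elim=> {x} [|q x y _ Fx _ Fy|g g' phi pu|g].
- exact: fglift0.
- by rewrite fglift_linear Fx Fy mulr0 addr0.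
- by rewrite fgliftB !liftU !scale1r (fc.1 _ _ _ pu) subrr.
- by rewrite fgliftD !liftU !scale1r (fc.2 g) addNr.
Qed.

Lemma gc_ext_pi x : gc_ext f (gc_pi x) = F x.
Proof.
apply/eqP; rewrite -subr_eq0; apply/eqP.
rewrite [LHS](_ : _ = F (generic_quotient.repr (gc_pi x) - x)).
  by apply/fglift_null/gc_piE/gc_piK.
by rewrite fgliftB.
Qed.

Lemma gc_extP g : gc_ext f (gc_class g) = f g.
Proof. by rewrite gc_ext_pi liftU scale1r. Qed.

Lemma gc_ext_linear q X Y : gc_ext f (q *: X + Y) = q * gc_ext f X + gc_ext f Y.
Proof.
rewrite -[X]gc_piK -[Y]gc_piK -gc_piZ -gc_piD !gc_ext_pi.
by rewrite fglift_linear.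
Qed.

End Extension.

Section CardAut.
Variables (V E H V' E' H' : finType).
Variables (G : hgraph V E H) (G' : hgraph V' E' H').

Lemma conj_inj (T T' : finType) (f : T -> T') (g : T' -> T) (s : {perm T}) :
  cancel g f -> cancel f g -> injective (fun x => f (s (g x))).
Proof.
by move=> gK fK; apply: (inj_comp (can_inj fK)); apply: (inj_comp perm_inj (can_inj gK)).
Qed.

Lemma card_aut_le (phi : giso G G') : (card_aut G <= card_aut G')%N.
Proof.
have [gv vK kv] := iso_v_bij phi; have [ge eK ke] := iso_e_bij phi.
have [gh hK kh] := iso_h_bij phi.
pose c (t : {perm V} * {perm E} * {perm H}) :=
  (perm (@conj_inj _ _ _ _ t.1.1 kv vK), perm (@conj_inj _ _ _ _ t.1.2 ke eK),
   perm (@conj_inj _ _ _ _ t.2 kh hK)).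
have c_inj : injective c.
  move=> [[a b] d] [[a' b'] d'] [/permP/= ea /permP/= eb /permP/= ed].
  congr (_, _, _); apply/permP => x.
  - by have := ea (iso_v phi x); rewrite !permE !vK => /(can_inj vK).
  - by have := eb (iso_e phi x); rewrite !permE !eK => /(can_inj eK).
  - by have := ed (iso_h phi x); rewrite !permE !hK => /(can_inj hK).
rewrite /card_aut -(card_imset _ c_inj); apply: subset_leq_card.
apply/fintype.subsetP => _ /imsetP[t + ->]; rewrite !inE => /forallP ta.
apply/forallP => h'; rewrite /= !permE.
have /andP[/eqP te /eqP ti] := ta (gh h').
rewrite iso_edge_of iso_inc te ti -{2 4}[h']kh iso_edge_of iso_inc eK vK.
by rewrite !eqxx.
Qed.
End CardAut.

Lemma card_aut_iso (V E H V' E' H' : finType)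
    (G : hgraph V E H) (G' : hgraph V' E' H') :
  giso G G' -> card_aut G = card_aut G'.
Proof.
move=> phi; apply/eqP; rewrite eqn_leq card_aut_le//=.
have [gv vK kv] := iso_v_bij phi; have [ge eK ke] := iso_e_bij phi.
have [gh hK kh] := iso_h_bij phi.
apply: card_aut_le; apply: (@GIso _ _ _ _ _ _ G' G gv ge gh).
- by exists (iso_v phi).
- by exists (iso_e phi).
- by exists (iso_h phi).
- by move=> h; rewrite -{2}[h]kh iso_edge_of eK.
- by move=> h; rewrite -{2}[h]kh iso_inc vK.
Qed.

Lemma bidegree_iso (g g' : ograph) :
  giso (ugraph g) (ugraph g') -> bidegree g = bidegree g'.
Proof.
move=> phi; have := bij_eq_card (iso_v_bij phi); rewrite !card_ord => ev.
have := bij_eq_card (iso_e_bij phi); rewrite !card_ord => ee.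
by rewrite /bidegree /loops ev ee.
Qed.

(* < G, G' > = +|Aut G| or -|Aut G| if G ~ +G' or G ~ -G', and G' is not ~ 0 *)
Definition gen_pairing (g g' : ograph) : rat :=
  if gc_class g' == 0 then 0
  else if gc_class g == gc_class g' then (card_aut (ugraph g))%:R
  else if gc_class g == - gc_class g' then - (card_aut (ugraph g))%:R
  else 0.

Lemma gc_opp_eq (X : GC3) : X = - X -> X = 0.
Proof.
move=> /eqP; rewrite -addr_eq0 -mulr2n -scaler_nat => /eqP X0.
by rewrite -[X]scale1r -(@mulVf rat 2%:R)// -scalerA X0 scaler0.
Qed.

Lemma gen_pairing_compatr g : gc_compat (gen_pairing g).
Proof.
split=> [g1 g2 phi pu|g']; first by rewrite /gen_pairing (gc_class_iso pu).
rewrite /gen_pairing gc_class_opp oppr_eq0 opprK.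
have [|g'0] := eqVneq (gc_class g') 0; first by rewrite oppr0.
have [e1|_] := eqVneq (gc_class g) (- gc_class g'); last first.
  by case: eqP; rewrite ?oppr0.
case: eqP; last by rewrite opprK.
by rewrite e1 => /esym/gc_opp_eq/eqP; rewrite (negPf g'0).
Qed.

Lemma gen_pairing_oppl g g' :
  gen_pairing (opp_ograph g) g' = - gen_pairing g g'.
Proof.
rewrite /gen_pairing gc_class_opp eqr_opp.
have [|g'0] := eqVneq (gc_class g') 0; first by rewrite oppr0.
rewrite eqr_oppLR.
have [e1|_] := eqVneq (gc_class g) (- gc_class g'); last first.
  by case: eqP; rewrite ?oppr0.
case: eqP; last by rewrite opprK.
by rewrite e1 => /esym/gc_opp_eq/eqP; rewrite (negPf g'0).
Qed.

(* The subspace of bidegree b. *)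
Definition gc_homog (b : int * int) (X : GC3) : Prop :=
  exists2 s : seq (rat * ograph), all (fun p => bidegree p.2 == b) s &
    X = \sum_(p <- s) p.1 *: gc_class p.2.

Record GC3hat := Gc3Hat {
  gc_comp :> int * int -> GC3;
  gc_comp_homog : forall b, gc_homog b (gc_comp b)
}.

(* Graphs of distinct bidegrees are orthogonal, so that < G, Y > only involves
   the component of Y in the bidegree of G. *)
Definition graph_pairing (Y : GC3hat) (g : ograph) : rat :=
  gc_ext (gen_pairing g) (Y (bidegree g)).

Definition gc_pairing (X : GC3) (Y : GC3hat) : rat :=
  gc_ext (graph_pairing Y) X.

Lemma graph_pairing_compat Y : gc_compat (graph_pairing Y).
Proof.
have extN (f f' : ograph -> rat) X : (forall g, f' g = - f g) ->
    gc_ext f' X = - gc_ext f X.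
  move=> ff'; rewrite /gc_ext -[generic_quotient.repr X]freeg_sumE.
  rewrite !(big_morph _ (@fgliftD _) (fglift0 _)) -sumrN; apply: eq_bigr => g _.
  by rewrite !liftU ff'; exact: mulrN.
split=> [g g' phi pu|g].
  rewrite /graph_pairing (bidegree_iso phi); congr (gc_ext _ _).
  apply/funext => h; rewrite /gen_pairing (gc_class_iso pu).
  by rewrite (card_aut_iso phi).
by apply: extN => g'; exact: gen_pairing_oppl.
Qed.

Lemma gc_pairing_class g Y : gc_pairing (gc_class g) Y = graph_pairing Y g.
Proof. exact/gc_extP/graph_pairing_compat. Qed.

Lemma gc_pairing_linear q X X' Y :
  gc_pairing (q *: X + X') Y = q * gc_pairing X Y + gc_pairing X' Y.
Proof. exact/gc_ext_linear/graph_pairing_compat. Qed.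

(* Edge e of D_m consists of the half-edges lshift m e, at the vertex 0, and
   rshift m e, at the vertex 1. *)
Section Dipole.
Variable m : nat.

Definition dip_edge (h : 'I_(m + m)) : 'I_m :=
  match fintype.split h with inl e => e | inr e => e end.

Definition dip_inc (h : 'I_(m + m)) : 'I_2 :=
  match fintype.split h with inl _ => ord0 | inr _ => ord_max end.

Lemma dip_edge_l e : dip_edge (lshift m e) = e.
Proof. by rewrite /dip_edge (unsplitK (inl e)). Qed.
Lemma dip_edge_r e : dip_edge (rshift m e) = e.
Proof. by rewrite /dip_edge (unsplitK (inr e)). Qed.
Lemma dip_inc_l e : dip_inc (lshift m e) = ord0.
Proof. by rewrite /dip_inc (unsplitK (inl e)). Qed.
Lemma dip_inc_r e : dip_inc (rshift m e) = ord_max.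
Proof. by rewrite /dip_inc (unsplitK (inr e)). Qed.

Lemma dip_edge_card e : #|[set h | dip_edge h == e]| = 2%N.
Proof.
rewrite (_ : [set h | _] = [set lshift m e; rshift m e]).
  by rewrite cards2 eq_lrshift.
apply/setP => h; rewrite !inE -[h]splitK; case: fintype.split => k /=.
  by rewrite dip_edge_l eq_lshift eq_lrshift orbF.
by rewrite dip_edge_r eq_rlshift eq_rshift.
Qed.

Definition dipole_graph : hgraph 'I_2 'I_m 'I_(m + m) :=
  HGraph dip_inc dip_edge_card.

Definition dipole_dir : directions dipole_graph :=
  @Directions _ _ _ dipole_graph (@lshift m m) dip_edge_l.

Hypothesis m_ge3 : (2 < m)%N.

Lemma dipole_connected : gconnected dipole_graph.
Proof.
rewrite /gconnected card_ord /=; apply/forallP => v; apply/forallP => w.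
have [->|vw] := eqVneq v w; first exact: connect0.
have e : 'I_m by exact: (Ordinal (ltn_trans (ltn0Sn 1) m_ge3)).
apply: connect1; apply/existsP.
have [v0|v1] : v = ord0 \/ v = ord_max.
  by case: v {vw} => [[|[|//]] ?]; [left|right]; exact/val_inj.
- exists (lshift m e); apply/existsP; exists (rshift m e).
  rewrite /= dip_edge_l dip_edge_r dip_inc_l dip_inc_r v0 !eqxx /=.
  by move: vw; rewrite v0; case: w => [[|[|//]] ?].
- exists (rshift m e); apply/existsP; exists (lshift m e).
  rewrite /= dip_edge_l dip_edge_r dip_inc_l dip_inc_r v1 !eqxx /=.
  by move: vw; rewrite v1; case: w => [[|[|//]] ?].
Qed.

Lemma dipole_valency : valency_ge3 dipole_graph.
Proof.
apply/forallP => v; apply: (leq_trans m_ge3).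
have [v0|v1] : v = ord0 \/ v = ord_max.
  by case: v => [[|[|//]] ?]; [left|right]; exact/val_inj.
- rewrite -[X in (X <= _)%N]card_ord -(card_imset _ (@lshift_inj m m)).
  apply: subset_leq_card; apply/fintype.subsetP => _ /imsetP[e _ ->].
  by rewrite inE /= dip_inc_l v0.
- rewrite -[X in (X <= _)%N]card_ord -(card_imset _ (@rshift_inj m m)).
  apply: subset_leq_card; apply/fintype.subsetP => _ /imsetP[e _ ->].
  by rewrite inE /= dip_inc_r v1.
Qed.

Definition dipole : ograph :=
  OGraph dipole_connected dipole_valency (std_orientation 1%g dipole_dir).
End Dipole.

Lemma odd_ge3 j : (2 < (j.+1.*2).+1)%N. Proof. by []. Qed.

(* D_{2i+1} / (2 (2i+1)!) for i = j + 1 *)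
Definition mm_term (j : nat) : GC3 :=
  (2 * ((j.+1.*2).+1)`!)%:R^-1 *: gc_class (dipole (odd_ge3 j)).

Definition mm_bidegree (j : nat) : int * int := bidegree (dipole (odd_ge3 j)).

Lemma mm_bidegreeE j :
  mm_bidegree j = ((j.+1.*2)%:Z, 1 - 4 * j.+1%:Z).
Proof. by rewrite /mm_bidegree /bidegree /loops /=; congr pair; lia. Qed.

(* The component in bidegree b of \sum_(i >= 1) D_{2i+1} / (2 (2i+1)!): only
   finitely many terms have bidegree b, see [mm_comp_bound]. *)
Definition mm_comp (b : int * int) : GC3 :=
  \sum_(j < `|b.1|%N | mm_bidegree j == b) mm_term j.

Lemma mm_comp_bound j b : mm_bidegree j = b -> (j < `|b.1|)%N.
Proof. by move=> <-; rewrite mm_bidegreeE /=; lia. Qed.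

Lemma mm_comp_homog b : gc_homog b (mm_comp b).
Proof.
pose s := [seq ((2 * (((val j).+1.*2).+1)`!)%:R^-1 : rat, dipole (odd_ge3 j))
          | j : 'I_(`|b.1|%N) <- enum 'I_(`|b.1|%N) & mm_bidegree j == b].
exists s; first by rewrite all_map; apply/allP => j; rewrite mem_filter => /andP[].
by rewrite big_map big_filter big_enum_cond.
Qed.

Definition mm : GC3hat := Gc3Hat mm_comp_homog.

(* Lebesgue measure on R^n, as the n-fold product of Lebesgue measure on R. *)
Section LebesgueTuple.
Variable R : realType.
Local Open Scope ereal_scope.
Local Open Scope classical_set_scope.
Local Notation leb := (@lebesgue_measure R).

Definition tuple_cons n (p : measurableTypeR R * n.-tuple (measurableTypeR R)) :
    n.+1.-tuple (measurableTypeR R) :=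
  [tuple of p.1 :: p.2].

Lemma measurable_tuple_cons n : measurable_fun setT (@tuple_cons n).
Proof. exact: (measurable_cons (measurable_fst) (measurable_snd)). Qed.

Definition tuple_uncons n (t : n.+1.-tuple (measurableTypeR R)) :
    measurableTypeR R * n.-tuple (measurableTypeR R) :=
  (thead t, [tuple of behead t]).

Lemma measurable_tuple_uncons n : measurable_fun setT (@tuple_uncons n).
Proof.
apply/measurable_fun_pairP; split; first exact: measurable_tnth.
exact: measurable_behead.
Qed.

Lemma tuple_consK n : cancel (@tuple_cons n) (@tuple_uncons n).
Proof.
move=> -[x t]; rewrite /tuple_uncons theadE; congr (_, _).
exact/val_inj.
Qed.

Section step.
Variables (n : nat).
Variable (mu : {sigma_finite_measure set (n.-tuple (measurableTypeR R)) -> \bar R}).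

Definition lebesgue_cons : set (n.+1.-tuple (measurableTypeR R)) -> \bar R :=
  pushforward (leb \x mu) (@tuple_cons n).

HB.instance Definition _ := Measure.copy lebesgue_cons
  (measure_function_pushforward__canonical__measure_function_Measure
     (leb \x mu) (@measurable_tuple_cons n)).

Let lebesgue_cons_sigma_finite : sigma_finite setT lebesgue_cons.
Proof.
have [F [TF mF]] : exists F : (set (measurableTypeR R *
    n.-tuple (measurableTypeR R))%type)^nat, setT = \bigcup_k F k /\
    forall k, measurable (F k) /\ (leb \x mu) (F k) < +oo.
  have /sigma_finiteP[F [TF ndF Foo]] := @sigma_finiteT _ _ _ leb.
  have /sigma_finiteP[G [TG ndG Goo]] := sigma_finiteT mu.
  exists (fun k => F k `*` G k); split.
    rewrite -setXTT TF TG predeqE => -[x y]; split.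
      move=> [/= [k _ Fkx] [l _ Gly]]; exists (maxn k l) => //; split.
      - by move: x Fkx; exact/subsetPset/ndF/leq_maxl.
      - by move: y Gly; exact/subsetPset/ndG/leq_maxr.
    by move=> [k _ []/= ? ?]; split; exists k.
  move=> k; have [? ?] := Foo k; have [? ?] := Goo k.
  split; first exact: measurableX.
  by rewrite product_measure1E// lte_mul_pinfty// ge0_fin_numE.
have cK : cancel (@tuple_uncons n) (@tuple_cons n).
  by move=> t; apply/val_inj => /=; rewrite {3}(tuple_eta t).
exists (fun k => @tuple_uncons n @^-1` F k).
  by rewrite -preimage_bigcup -TF preimage_setT.
move=> k; have [mFk Fkoo] := mF k; split.
  by rewrite -[X in measurable X]setTI; exact: measurable_tuple_uncons.
rewrite /lebesgue_cons /pushforward -comp_preimage.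
rewrite (_ : _ \o _ = id) ?preimage_id//.
by apply/funext => p /=; exact: tuple_consK.
Qed.

HB.instance Definition _ := Measure_isSigmaFinite.Build _ _ _ lebesgue_cons
  lebesgue_cons_sigma_finite.

End step.

Fixpoint lebesgue_tuple n :
    {sigma_finite_measure set (n.-tuple (measurableTypeR R)) -> \bar R} :=
  if n is n'.+1 then lebesgue_cons (lebesgue_tuple n') else dirac [tuple].
End LebesgueTuple.

(* The exterior algebra of the dual of R^m: S is the coordinate of
   dx_{i_1} /\ ... /\ dx_{i_k}, where S = {i_1 < ... < i_k}. *)
Definition ext (R : realType) (m : nat) := {ffun {set 'I_m} -> R}.

Section Exterior.
Variables (R : realType) (m : nat).

Definition ext1 : ext R m := [ffun S : {set 'I_m} => (S == finset.set0)%:R].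

Definition dx (i : 'I_m) : ext R m :=
  [ffun S : {set 'I_m} => (S == finset.set1 i)%:R].

(* The number of transpositions needed to sort the elements of S followed by
   those of T. *)
Definition shuffle_inv (S T : {set 'I_m}) : nat :=
  #|[set p : 'I_m * 'I_m | (p.1 \in S) && (p.2 \in T) && (p.2 < p.1)%N]|.

Definition wedge (a b : ext R m) : ext R m :=
  [ffun U : {set 'I_m} => \sum_(S : {set 'I_m} | S \subset U)
     (-1) ^+ shuffle_inv S (U :\: S) * a S * b (U :\: S)].

(* Pf M = 1/(2^k k!) \sum_sigma sgn(sigma) \prod_i M_{sigma(2i-1), sigma(2i)}
   for matrices of forms of even degree, of even size l = 2k; the indices start
   at 0 below. *)
Definition pfaffian (l : nat) (M : 'M[ext R m]_l) : ext R m :=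
  (2 ^ l./2 * (l./2)`!)%:R^-1 *:
  \sum_(s : 'S_l) (-1) ^+ s *:
    \big[wedge/ext1]_(i < l | ~~ odd i) M (s i) (s (ordS i)).

(* The matrix dX X^-1 dX of 2-forms, given X and a matrix dX of 1-forms. *)
Definition dXXdX (l : nat) (X : 'M[R]_l) (dX : 'M[ext R m]_l) :
    'M[ext R m]_l :=
  \matrix_(a, b) \sum_c \sum_d invmx X c d *: wedge (dX a c) (dX d b).

(* phi^l at a positive definite matrix X, pulled back along a map with
   differential dX. *)
Definition phi_form (l : nat) (X : 'M[R]_l) (dX : 'M[ext R m]_l) : ext R m :=
  if odd l then 0
  else (Num.sqrt (\det X))^-1 *: pfaffian (dXXdX X dX).

Variables (l : nat) (C : 'M[int]_(m, l)).
Local Notation CR := (map_mx (fun z : int => z%:~R : R) C).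

Definition Lambda (x : 'rV[R]_m) : 'M[R]_l := CR^T *m diag_mx x *m CR.

Definition dLambda : 'M[ext R m]_l :=
  \matrix_(a, b) \sum_e (CR e a * CR e b) *: dx e.

Definition phi_graph (x : 'rV[R]_m) : ext R m := phi_form (Lambda x) dLambda.

End Exterior.

Section ProjectiveIntegral.
Variables (R : realType) (l : nat).

(* The open simplex in P^m is the orthant R_{>0}^m in the chart x_1 = 1 (index
   0 below), where \sum_i (-1)^(i-1) x_i dx_1 .. ^dx_i .. dx_{m+1} restricts to
   dx_2 ... dx_{m+1}. *)
Definition chart (m : nat) (y : m.-tuple R) : 'rV[R]_m.+1 :=
  \row_i tnth [tuple of 1 :: y] i.

Definition orthant (m : nat) : set (m.-tuple (measurableTypeR R)) :=
  [set y | forall i, 0 < (tnth y i : R)]%classic.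

Arguments orthant m : clear implicits.

Definition simplex_density (m : nat) (C : 'M[int]_(m.+1, l))
    (y : m.-tuple (measurableTypeR R)) : R :=
  phi_graph C (chart y) [set~ ord0].

Definition simplex_convergent (m : nat) : 'M[int]_(m, l) -> Prop :=
  match m with
  | 0 => fun=> True
  | m'.+1 => fun C => l = m' ->
      (lebesgue_tuple R m').-integrable (orthant m')
        (EFin \o simplex_density C)
  end.

Definition simplex_integral (m : nat) : 'M[int]_(m, l) -> R :=
  match m with
  | 0 => fun=> 0
  | m'.+1 => fun C =>
      if l == m' then
        \int[lebesgue_tuple R m']_(y in orthant m') simplex_density C y
      else 0
  end.

(* (-2 pi)^(l/2) is only needed for even l, as phi^l = 0 for l odd. *)
Definition graph_integral_basis (m : nat) (C : 'M[int]_(m, l)) : R :=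
  ((- (2 * pi)) ^+ l./2)^-1 * simplex_integral C.

End ProjectiveIntegral.

Section Presentations.
Variables (V E H : finType) (G : hgraph V E H).

(* The boundary (head minus tail) of the 1-chain \sum_e z_e o_e, where e is at
   the position epos e. *)
Definition bdry (m : nat) (d : directions G) (epos : E -> 'I_m)
    (z : 'cV[int]_m) (v : V) : int :=
  \sum_(h | inc G h == v)
     (if h == d (edge_of G h) then -1 else 1) * z (epos (edge_of G h)) 0.

(* The data relating v_1 /\ ... /\ v_n (x) (x)_e o_e to
   (det A) e_1 /\ ... /\ e_m (x) C_1 /\ ... /\ C_l, with n = k + 1 and
   m = l + k. *)
Record presentation := Presentation {
  p_loops : nat;
  p_rank : nat;
  p_order : {perm V};
  p_dir : directions G;
  p_epos : E -> 'I_(p_loops + p_rank);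
  p_cycles : 'M[int]_(p_loops + p_rank, p_loops);
  p_arcs : 'M[int]_(p_loops + p_rank, p_rank);
  p_card : #|V| = p_rank.+1;
  p_epos_bij : bijective p_epos;
  p_cycles_basis : forall z : 'cV[int]_(p_loops + p_rank),
    (forall v, bdry p_dir p_epos z v = 0) <->
    (exists! c : 'cV[int]_p_loops, z = p_cycles *m c);
  p_arcs_bdry : forall (i : 'I_p_rank) v,
    bdry p_dir p_epos (col i p_arcs) v =
    (vpos p_order v == i.+1 :> nat)%:R - (vpos p_order v == 0 :> nat)%:R
}.

(* The sign of o relative to e_1 /\ ... /\ e_m (x) C_1 /\ ... /\ C_l. *)
Definition p_sign (o : orientation G) (p : presentation) : int :=
  o (p_order p) (p_dir p) * \det (row_mx (p_cycles p) (p_arcs p)).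

Definition presented_integral (R : realType) (o : orientation G)
    (p : presentation) : R :=
  (p_sign o p)%:~R * graph_integral_basis R (p_cycles p).

(* Both predicates quantify over all presentations of G: the value and the
   convergence of the integral must not depend on the choice.  The orientation
   only affects the sign of the integral. *)
Definition graph_integral_convergent (R : realType) (o : orientation G) :
    Prop :=
  inhabited presentation /\
  forall p : presentation, simplex_convergent R (p_cycles p).

Definition is_graph_integral (R : realType) (o : orientation G) (r : R) :
    Prop :=
  inhabited presentation /\
  forall p : presentation, r = presented_integral R o p.

End Presentations.

(* Main.v *)
(* Only graphs with two vertices contribute, because the integrand has degree
   l = m - 1.  If k spans the orthogonal complement of H_1 in Z^m, then up to a
   common sign k_e is 0 on self-loops and +1 or -1 on the other edges, and with
   s = \sum_e k_e^2 / x_e one has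
     det X = s \prod_e x_e,   C X^-1 C^T = D^-1 - s^-1 D^-1 k k^T D^-1,
   where D = diag(x).  Since dx_e /\ dx_e = 0, the matrix dX X^-1 dX is
   - s^-1 eta eta^T for the vector of 1-forms eta = C^T (k_e dx_e / x_e)_e, so its
   Pfaffian is (l - 1)!! (- 1 / s)^(l/2) eta_1 /\ ... /\ eta_l.  The density of
   the integral is thus a constant times
     \prod_e k_e * \prod_e x_e^(-3/2) * s^(-(l+1)/2);
   it vanishes if there is a self-loop, and otherwise it is integrated one
   variable at a time, each step being a Wallis integral.  The product of the
   powers of -2 pi cancels, and the integral is the sign \prod_e k_e of the
   graph relative to the dipole.  This sign is a well-defined linear form on
   GC_3, so that the dipoles with an odd number of edges are not ~ 0 and graphs
   with self-loops are orthogonal to them. *)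
Require Import Defs.
From mathcomp Require Import all_boot all_order all_algebra all_fingroup.
From mathcomp Require Import all_classical all_reals all_analysis.
From mathcomp Require Import measurable_realfun.
From mathcomp Require Import ring lra zify.
Set Implicit Arguments.
Unset Strict Implicit.
Unset Printing Implicit Defensive.
Import Order.TTheory GRing.Theory Num.Theory numFieldNormedType.Exports.
Local Open Scope ring_scope.

(** * Exterior powers and Pfaffians *)

Section Wedge.
Variables (R : realType) (m : nat).
Implicit Types a b c : ext R m.
Implicit Types S T U : {set 'I_m}.

Lemma wedgeDl a b c : wedge (a + b) c = wedge a c + wedge b c.
Proof.
apply/ffunP => U; rewrite !ffunE -big_split /=; apply: eq_bigr => S _.
by rewrite ffunE; ring.
Qed.

Lemma wedgeDr a b c : wedge a (b + c) = wedge a b + wedge a c.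
Proof.
apply/ffunP => U; rewrite !ffunE -big_split /=; apply: eq_bigr => S _.
by rewrite ffunE; ring.
Qed.

Lemma wedgeZl (k : R) a b : wedge (k *: a) b = k *: wedge a b.
Proof.
apply/ffunP => U; rewrite !ffunE scaler_sumr; apply: eq_bigr => S _.
by rewrite ffunE /GRing.scale /=; ring.
Qed.

Lemma wedgeZr (k : R) a b : wedge a (k *: b) = k *: wedge a b.
Proof.
apply/ffunP => U; rewrite !ffunE scaler_sumr; apply: eq_bigr => S _.
by rewrite ffunE /GRing.scale /=; ring.
Qed.

Lemma wedge0l a : wedge 0 a = 0.
Proof. by apply/ffunP => U; rewrite !ffunE big1 // => S _; rewrite ffunE mulr0 mul0r. Qed.

Lemma wedge0r a : wedge a 0 = 0.
Proof. by apply/ffunP => U; rewrite !ffunE big1 // => S _; rewrite ffunE mulr0. Qed.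

Lemma wedge_suml (I : Type) (r : seq I) (F : I -> ext R m) b :
  wedge (\sum_(i <- r) F i) b = \sum_(i <- r) wedge (F i) b.
Proof. by elim: r => [|i r IH]; rewrite !(big_nil, big_cons) ?wedge0l // wedgeDl IH. Qed.

Lemma wedge_sumr (I : Type) (r : seq I) (F : I -> ext R m) b :
  wedge b (\sum_(i <- r) F i) = \sum_(i <- r) wedge b (F i).
Proof. by elim: r => [|i r IH]; rewrite !(big_nil, big_cons) ?wedge0r // wedgeDr IH. Qed.

Lemma shuffle_invE S T :
  shuffle_inv S T = (\sum_(i in S) \sum_(j in T) (j < i))%N.
Proof.
rewrite /shuffle_inv -sum1_card pair_big_dep /= big_mkcond [RHS]big_mkcond /=.
by apply: eq_bigr => -[i j] _; rewrite inE /=; case: (i \in S); case: (j \in T); case: (j < i)%N.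
Qed.

Lemma shuffle_invUl S T U : [disjoint S & T] ->
  shuffle_inv (S :|: T) U = (shuffle_inv S U + shuffle_inv T U)%N.
Proof.
move=> dST; rewrite !shuffle_invE (eq_bigl [predU S & T]) ?bigU //.
by move=> i; rewrite !inE.
Qed.

Lemma shuffle_invUr S T U : [disjoint T & U] ->
  shuffle_inv S (T :|: U) = (shuffle_inv S T + shuffle_inv S U)%N.
Proof.
move=> dTU; rewrite !shuffle_invE -big_split; apply: eq_bigr => i _.
by rewrite (eq_bigl [predU T & U]) ?bigU // => j; rewrite !inE.
Qed.

(** Both sides sum over the ordered splittings of [U] into three blocks. The signs agree because
    [shuffle_inv] is additive over disjoint unions in each argument. *)
Lemma wedgeA a b c : wedge a (wedge b c) = wedge (wedge a b) c.
Proof.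
apply/ffunP => U; rewrite !ffunE.
under [RHS]eq_bigr => X _ do rewrite ffunE mulr_sumr mulr_suml.
rewrite (exchange_big_dep (fun S => S \subset U)) /=; last first.
  by move=> X S XU SX; exact: fintype.subset_trans SX XU.
apply: eq_bigr => S SU; rewrite ffunE mulr_sumr.
(* The outer sum on the right runs over the union of the first two blocks; it becomes a sum over the
   second block. *)
rewrite [RHS](reindex_onto (fun T => S :|: T) (fun X => X :\: S)) /=; last first.
  by move=> X /andP[_ SX]; rewrite finset.setDE finset.setUIr finset.setUCr finset.setIT;
     apply/finset.setUidPr.
apply: eq_big => T.
  rewrite finset.subUset SU finset.subsetUl andbT /= finset.setDUl finset.setDv finset.set0U.
  rewrite finset.subsetD; congr (_ && _); apply/idP/eqP => [/finset.setDidPl //|<-].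
  rewrite -finset.setI_eq0; apply/eqP/setP => i; rewrite !inE.
  by case: (i \in S); rewrite ?andbF.
rewrite finset.subsetD => /andP[TU dTS].
have dST : [disjoint S & T] by rewrite disjoint_sym.
have eT : (S :|: T) :\: S = T.
  by rewrite finset.setDUl finset.setDv finset.set0U; apply/finset.setDidPl.
have eU : U :\: S :\: T = U :\: (S :|: T) by rewrite finset.setDDl.
have eUS : U :\: S = T :|: U :\: (S :|: T).
  rewrite -finset.setDDl -[LHS](finset.setID _ T); congr (_ :|: _).
  by apply/finset.setIidPr; rewrite finset.subsetD TU.
have dTX : [disjoint T & U :\: (S :|: T)].
  rewrite -finset.setI_eq0; apply/eqP/setP => i; rewrite !inE.
  by case: (i \in T); rewrite ?orbT ?andbF.
rewrite eT eU shuffle_invUl // eUS shuffle_invUr // !exprD; ring.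
Qed.

Lemma wedge_dx (e : 'I_m) a U :
  wedge (dx R e) a U =
  if e \in U then (-1) ^+ #|[set f in U | (f < e)%N]| * a (U :\ e) else 0.
Proof.
rewrite ffunE; under eq_bigr => S _ do rewrite ffunE.
have [eU|eU] := boolP (e \in U); last first.
  rewrite big1 // => S SU; have [SE|] := eqVneq S [set e]%SET; last by rewrite mulr0 mul0r.
  by move: SU; rewrite SE finset.sub1set (negPf eU).
rewrite (bigD1 [set e]%SET) ?finset.sub1set //= eqxx mulr1 big1 ?addr0; last first.
  by move=> S /andP[_ /negPf->]; rewrite mulr0 mul0r.
congr (_ ^+ _ * _); rewrite shuffle_invE big_set1.
rewrite -sum1_card big_mkcond [RHS]big_mkcond; apply: eq_bigr => f _.
by rewrite !inE; have [->|] := eqVneq f e; rewrite ?ltnn ?andbF //=; case: (f \in U); case: ltnP.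
Qed.
End Wedge.

(* Expanding the wedge product with the first form is the Laplace expansion
   along the first row. *)
Lemma wedge_1forms (R : realType) (m k : nat) (W : 'I_k -> 'I_m -> R)
    (g : 'I_k -> 'I_m) : {homo g : i j / (i < j)%N} ->
  (\big[@wedge R m/ext1 R m]_(i < k) \sum_e W i e *: dx R e)
    [set g i | i : 'I_k]%SET = \det (\matrix_(i, j) W i (g j)).
Proof.
elim: k W g => [|k IH] W g g_mono.
  rewrite big_ord0 det_mx00 ffunE (_ : [set g i | i : 'I_0]%SET = finset.set0) ?eqxx //.
  by apply/setP => e; rewrite inE; apply/imsetP => -[[]].
rewrite big_ord_recl /= wedge_suml sum_ffunE.
have g_inj : injective g.
  move=> i j gij; apply/val_inj; case: (ltngtP i j) => // /g_mono; rewrite gij ltnn //.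
rewrite (expand_det_row _ ord0).
under [LHS]eq_bigr => e _ do rewrite wedgeZl ffunE wedge_dx.
rewrite (bigID (fun e => e \in [set g i | i : 'I_k.+1]%SET)) /= [X in _ + X]big1 ?addr0; last first.
  by move=> e /negPf->; rewrite scaler0.
rewrite big_imset /=; last by move=> i j _ _ /g_inj.
apply: eq_bigr => j _; rewrite imset_f //= mxE /GRing.scale /=; congr (_ * _).
rewrite /cofactor add0n.
have -> : ([set g i | i : 'I_k.+1] :\ g j)%SET = [set g (lift j i) | i : 'I_k]%SET.
  apply/setP => e; rewrite !inE; apply/andP/imsetP => [[ne /imsetP[i _ ei]]|[i _ ->]].
    case: (unliftP j i) ei => [i' ->|-> ei]; first by exists i'.
    by rewrite ei eqxx in ne.
  by rewrite (inj_eq g_inj) eq_sym neq_lift imset_f.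
rewrite (IH (fun i => W (lift ord0 i)) (fun i => g (lift j i))); last first.
  move=> a b ab; apply: g_mono; rewrite /= /bump; lia.
congr (_ ^+ _ * _); last by congr (\det _); apply/matrixP => a b; rewrite !mxE.
(* The sign exponent counts the elements of the image below [g j]. By monotonicity these are the
   [g a] with a < j, which gives the sign of the cofactor. *)
have lt_j (a : 'I_j) : (a < k.+1)%N by rewrite (ltn_trans (ltn_ord a)).
rewrite -[RHS](card_ord j).
rewrite -(card_imset _ (_ : injective (fun a : 'I_j => g (Ordinal (lt_j a))))); last first.
  by move=> a b /g_inj [ab]; exact/val_inj.
apply: eq_card => e; rewrite inE; apply/andP/imsetP => [[/imsetP[i _ ->] gij]|[i _ ->]].
  have ij : (i < j)%N.
    rewrite ltnNge leq_eqVlt; apply/negP => /orP[/eqP/val_inj ij|/g_mono]; last lia.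
    by rewrite ij ltnn in gij.
  by exists (Ordinal ij) => //; congr g; exact/val_inj.
by rewrite imset_f //; split=> //; apply: g_mono => /=.
Qed.

Section Pfaffian.
Variables (R : realType) (m : nat).

(** Associativity flattens the pairs and the scalars factor out. The index function lives on [nat]
    so that the induction can shift it by two. *)
Lemma big_wedge_pairs (T : Type) (n : nat) (c : R) (eta : T -> ext R m)
    (t : nat -> T) :
  \big[@wedge R m/ext1 R m]_(0 <= i < n.*2 | ~~ odd i)
     (c *: wedge (eta (t i)) (eta (t i.+1))) =
  c ^+ n *: \big[@wedge R m/ext1 R m]_(0 <= i < n.*2) eta (t i).
Proof.
elim: n t => [|n IH] t; first by rewrite !big_nil scale1r.
rewrite doubleS big_ltn_cond //= big_ltn_cond //= !big_add1 /=.
rewrite [in RHS]big_ltn // [in RHS]big_ltn // !big_add1 /=.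
under eq_bigl => i do rewrite negbK.
by rewrite (IH (fun i => t i.+2)) wedgeZl wedgeZr scalerA -wedgeA exprS.
Qed.

Lemma pfaffian_term (n : nat) (c : R) (eta : 'I_n.*2 -> ext R m) (s : 'S_n.*2) :
  \big[@wedge R m/ext1 R m]_(i < n.*2 | ~~ odd i)
     (\matrix_(a, b) (c *: wedge (eta a) (eta b))) (s i) (s (ordS i)) =
  c ^+ n *: \big[@wedge R m/ext1 R m]_(i < n.*2) eta (s i).
Proof.
case: n eta s => [|n] eta s; first by rewrite !big_ord0 scale1r.
pose t i := s (inord i : 'I_n.+1.*2).
have := big_wedge_pairs n.+1 c eta t; rewrite !big_mkord.
have -> : \big[@wedge R m/ext1 R m]_(i < n.+1.*2) eta (t i) =
    \big[@wedge R m/ext1 R m]_(i < n.+1.*2) eta (s i).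
  by apply: eq_bigr => i _; rewrite /t inord_val.
move=> <-; apply: eq_bigr => i i_even; rewrite mxE /t inord_val.
(* An even index is never the last one of an even range, so [ordS] does not wrap around. *)
have ltiS : (i.+1 < n.+1.*2)%N by have := ltn_ord i; move: i_even; move: (nat_of_ord i) => k; lia.
by congr (c *: wedge _ (eta (s _))); apply/val_inj; rewrite /= inordK ?modn_small.
Qed.

(** All (2n)! permutations contribute equally: the sign in the Pfaffian cancels the sign from
    permuting the rows of the determinant. *)
Lemma pfaffian_rank1 (n : nat) (c : R) (W : 'I_n.*2 -> 'I_m -> R)
    (g : 'I_n.*2 -> 'I_m) (eta := fun a => \sum_e W a e *: dx R e) :
  {homo g : i j / (i < j)%N} ->
  pfaffian (\matrix_(a, b) (c *: wedge (eta a) (eta b)))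
    [set g i | i : 'I_n.*2]%SET =
  (n.*2)`!%:R / (2 ^ n * n`!)%:R * c ^+ n * \det (\matrix_(i, j) W i (g j)).
Proof.
move=> g_mono; rewrite /pfaffian.
rewrite ffunE sum_ffunE /GRing.scale /= doubleK.
transitivity ((2 ^ n * n`!)%:R^-1 *
    \sum_(s : 'S_n.*2) c ^+ n * \det (\matrix_(i, j) W i (g j))).
  congr (_ * _); apply: eq_bigr => s _; rewrite pfaffian_term !ffunE /GRing.scale /=.
  rewrite (wedge_1forms (fun i => W (s i)) g_mono).
  rewrite (_ : (\matrix_(i, j) W (s i) (g j)) = row_perm s (\matrix_(i, j) W i (g j))); last first.
    by apply/matrixP => i j; rewrite !mxE.
  rewrite row_permE det_mulmx det_perm [LHS]mulrCA; congr (_ * _).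
  by rewrite mulrA -expr2 sqrr_sign mul1r.
by rewrite sumr_const card_Sn -[X in _ * X = _]mulr_natl mulrCA !mulrA.
Qed.
End Pfaffian.

(** * The Gram matrix of a hyperplane *)

Section Border.
Variables (F : comNzRingType).

(** Using [l.+1] columns instead of [l + 1] makes this a square matrix, without casts, when [C] has
    [l.+1] rows. *)
Definition border (m l : nat) (C : 'M[F]_(m, l)) (v : 'cV[F]_m) : 'M[F]_(m, l.+1) :=
  \matrix_(i, j) if unlift ord_max j is Some k then C i k else v i 0.

Lemma border_lift m l (C : 'M[F]_(m, l)) v i k :
  border C v i (lift ord_max k) = C i k.
Proof. by rewrite mxE liftK. Qed.

Lemma border_max m l (C : 'M[F]_(m, l)) v i : border C v i ord_max = v i 0.
Proof. by rewrite mxE unlift_none. Qed.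

Lemma mulmx_border p m l (A : 'M[F]_(p, m)) (C : 'M[F]_(m, l)) v :
  A *m border C v = border (A *m C) (A *m v).
Proof.
apply/matrixP => i j; case: (unliftP ord_max j) => [k ->|->].
  by rewrite border_lift !mxE; apply: eq_bigr => e _; rewrite border_lift.
by rewrite border_max !mxE; apply: eq_bigr => e _; rewrite border_max.
Qed.

Lemma border_castE l (C : 'M[F]_(l.+1, l)) (v : 'M[F]_(l.+1, 1)) :
  castmx (erefl, addn1 l) (row_mx C v) = border C v.
Proof.
apply/matrixP => i j; rewrite castmxE cast_ord_id.
case: (unliftP ord_max j) => [k ->|->].
  rewrite border_lift (_ : cast_ord _ _ = lshift 1 k) ?row_mxEl //.
  by apply/val_inj; rewrite /= /bump leqNgt ltn_ord.
rewrite border_max (_ : cast_ord _ _ = rshift l ord0) ?row_mxEr //.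
by apply/val_inj; rewrite /= addn0.
Qed.

(* The signed maximal minors of [C], that is, the vector k of the introduction. *)
Definition conormal (l : nat) (C : 'M[F]_(l.+1, l)) : 'cV[F]_l.+1 :=
  \col_e ((-1) ^+ (e + l) * \det (row' e C)).

(** Laplace expansion along the last column: [conormal C] represents the linear form that sends [v]
    to this determinant. *)
Lemma det_border l (C : 'M[F]_(l.+1, l)) v :
  \det (border C v) = \sum_e v e 0 * conormal C e 0.
Proof.
rewrite (expand_det_col _ ord_max); apply: eq_bigr => e _.
rewrite border_max mxE; congr (_ * (_ * \det (row' e _))).
by apply/matrixP => i j; rewrite mxE border_lift.
Qed.

Lemma sum_conormal l (C : 'M[F]_(l.+1, l)) k :
  \sum_e C e k * conormal C e 0 = 0.
Proof.
rewrite -[RHS](_ : \det (border C (col k C)) = 0).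
  by rewrite det_border; apply: eq_bigr => e _; rewrite [col _ _ _ _]mxE.
rewrite -det_tr; apply: (determinant_alternate (neq_lift ord_max k)) => e.
by rewrite 2![_^T _ _]mxE border_max border_lift mxE.
Qed.

Lemma conormal_orth l (C : 'M[F]_(l.+1, l)) : C^T *m conormal C = 0.
Proof.
apply/matrixP => k z; rewrite ord1 mxE [RHS]mxE -[RHS](sum_conormal C k).
by apply: eq_bigr => e _; rewrite [C^T _ _]mxE.
Qed.
End Border.

Lemma map_conormal (F F' : comNzRingType) (f : {rmorphism F -> F'}) l
    (C : 'M[F]_(l.+1, l)) : conormal (map_mx f C) = map_mx f (conormal C).
Proof.
apply/matrixP => e z; rewrite ord1 !mxE rmorphM rmorphXn rmorphN rmorph1 -det_map_mx.
by rewrite map_row'.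
Qed.

Section Gram.
Variables (F : fieldType) (l : nat) (C : 'M[F]_(l.+1, l)) (x : 'rV[F]_l.+1).
Let K := conormal C.
Let X := C^T *m diag_mx x *m C.
Let s := \sum_e K e 0 ^+ 2 / x 0 e.
Let Dinv : 'M[F]_l.+1 := diag_mx (map_mx GRing.inv x).
Hypothesis x_neq0 : forall e, x 0 e != 0.
Hypothesis s_neq0 : s != 0.

Let DinvK : Dinv *m diag_mx x = 1%:M.
Proof.
apply/matrixP => i j; rewrite mul_mx_diag !mxE.
by case: eqP => [->|]; rewrite ?mul0r // mulVf.
Qed.
Let KDinv : diag_mx x *m Dinv = 1%:M.
Proof. exact: mulmx1C DinvK. Qed.

(** The added column is orthogonal to those of [C] for the quadratic form [diag_mx x], so B^T D B is
    block diagonal with blocks [X] and [s]. *)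
Let B := border C (Dinv *m K).

Let detB : \det B = s.
Proof.
rewrite det_border; apply: eq_bigr => e _; rewrite mul_diag_mx mxE.
by rewrite [map_mx _ _ _ _]mxE -/K expr2; ring.
Qed.

(** The determinant of B^T D B is [\det X * s] by blocks and s^2 times the product of the x_e by
    multiplicativity; then [s] is cancelled. *)
Lemma det_gram : \det X = s * \prod_e x 0 e.
Proof.
apply: (mulIf s_neq0).
have -> : \det X * s = \det (B^T *m diag_mx x *m B).
  have E : B^T *m diag_mx x *m B = border (B^T *m diag_mx x *m C) (B^T *m K).
    by rewrite mulmx_border -!mulmxA (mulmxA (diag_mx x)) KDinv mul1mx.
  have EK i : (B^T *m K) i 0 = if i == ord_max then s else 0.
    rewrite mxE; case: (unliftP ord_max i) => [k ->|->].
      rewrite eq_sym (negPf (neq_lift _ _)).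
      rewrite -[RHS](sum_conormal C k); apply: eq_bigr => e _.
      by rewrite [B^T _ _]mxE border_lift.
    rewrite eqxx; apply: eq_bigr => e _.
    by rewrite [B^T _ _]mxE border_max mul_diag_mx mxE [map_mx _ _ _ _]mxE expr2; ring.
  rewrite E (expand_det_col _ ord_max) (bigD1 ord_max) //= big1 ?addr0; last first.
    by move=> i /negPf ne; rewrite border_max EK ne mul0r.
  rewrite border_max EK eqxx mulrC /cofactor -signr_odd oddD addbb mul1r.
  congr (_ * \det _); apply/matrixP => i j; rewrite [RHS]mxE [RHS]mxE border_lift.
  rewrite !mxE; apply: eq_bigr => e _; congr (_ * _); rewrite !mxE.
  by apply: eq_bigr => f _; rewrite !mxE liftK.
by rewrite !det_mulmx det_tr det_diag detB; ring.
Qed.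

Lemma gram_unit : X \in unitmx.
Proof.
rewrite unitmxE det_gram unitfE mulf_neq0 //.
by apply/prodf_neq0 => e _.
Qed.

(** It suffices to compare after multiplication by the invertible matrix D B: both sides then give
    [C] in the first columns and 0 in the last. *)
Lemma gram_inv :
  C *m invmx X *m C^T = Dinv - s^-1 *: (Dinv *m K *m K^T *m Dinv).
Proof.
set Q := LHS; set P := RHS.
have uB : B \in unitmx by rewrite unitmxE detB unitfE.
have KD : K^T *m Dinv *m K = s%:M.
  apply/matrixP => i j; rewrite !ord1 !mxE eqxx mulr1n; apply: eq_bigr => e _.
  by rewrite mul_mx_diag [X in X * _]mxE [map_mx _ _ _ _]mxE [K^T _ _]mxE expr2; ring.
have KC : K^T *m C = 0 by rewrite -[LHS]trmxK trmx_mul trmxK conormal_orth trmx0.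
have QB : Q *m diag_mx x *m B = P *m diag_mx x *m B.
  rewrite !mulmx_border; congr border.
    rewrite /Q -!mulmxA (mulmxA C^T) -/X mulVmx ?gram_unit // mulmx1.
    rewrite /P mulmxBl (mulmxA Dinv (diag_mx x)) DinvK mul1mx -scalemxAl -!mulmxA.
    by rewrite (mulmxA Dinv (diag_mx x)) DinvK mul1mx KC !mulmx0 scaler0 subr0.
  rewrite /Q -!mulmxA (mulmxA (diag_mx x)) KDinv mul1mx conormal_orth !mulmx0.
  rewrite /P mulmxBl -scalemxAl -!mulmxA (mulmxA K^T) KD.
  by rewrite -scalemx1 -scalemxAr mulmx1 -scalemxAr scalerA mulVf // scale1r subrr.
have := congr1 (mulmx^~ (invmx B)) QB; rewrite -!(mulmxA _ B) mulmxV // !mulmx1.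
by move=> /(congr1 (mulmx^~ Dinv)) /=; rewrite -!(mulmxA _ (diag_mx x)) KDinv !mulmx1.
Qed.
End Gram.

(** * The density on the simplex *)

Section Density.
Variables (R : realType) (n : nat) (C : 'M[int]_(n.*2.+1, n.*2)).
Local Notation l := n.*2.
Local Notation CR := (map_mx (fun z : int => z%:~R : R) C).
Let k e : R := (conormal C e 0)%:~R.

Let kE e : conormal CR e 0 = k e.
Proof. by rewrite map_conormal mxE. Qed.

Lemma wedge_lincomb m (p q : 'I_m -> R) :
  wedge (\sum_e p e *: dx R e) (\sum_f q f *: dx R f) =
  \sum_e \sum_f (p e * q f) *: wedge (dx R e) (dx R f).
Proof.
rewrite wedge_suml; apply: eq_bigr => e _; rewrite wedge_sumr; apply: eq_bigr => f _.
by rewrite wedgeZl wedgeZr scalerA.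
Qed.

Lemma wedge_dxx m (e : 'I_m) : wedge (dx R e) (dx R e) = 0.
Proof.
apply/ffunP => U; rewrite wedge_dx !ffunE; case: ifP => // eU.
have [E|] := eqVneq (U :\ e)%SET [set e]%SET; last by rewrite mulr0.
by have := finset.set11 e; rewrite -E !inE eqxx.
Qed.

Variable x : 'rV[R]_l.+1.
Hypothesis x_gt0 : forall e, 0 < x 0 e.
Let s := \sum_e k e ^+ 2 / x 0 e.
Hypothesis s_neq0 : s != 0.

Let x_neq0 e : x 0 e != 0. Proof. by rewrite gt_eqF. Qed.

Let sE : s = \sum_e conormal CR e 0 ^+ 2 / x 0 e.
Proof. by apply: eq_bigr => e _; rewrite kE. Qed.

Lemma dXXdX_rank1 :
  dXXdX (Lambda C x) (dLambda R C) =
  \matrix_(a, b) (- s^-1 *: wedge (\sum_e (CR e a * (k e / x 0 e)) *: dx R e)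
                                  (\sum_e (CR e b * (k e / x 0 e)) *: dx R e)).
Proof.
apply/matrixP => a b; rewrite !mxE wedge_lincomb.
under eq_bigr => c _ do under eq_bigr => d _ do
  rewrite !mxE wedge_lincomb pair_big scaler_sumr.
rewrite pair_big exchange_big /= scaler_sumr.
under [RHS]eq_bigr => e _ do rewrite scaler_sumr.
rewrite [RHS]pair_big /=; apply: eq_bigr => -[e f] _ /=.
rewrite scalerA; under eq_bigr => c _ do rewrite scalerA.
(* The diagonal entries of C X^-1 C^T only multiply dx_e /\ dx_e = 0; off the diagonal this matrix
   agrees with its rank one part. *)
rewrite -scaler_suml; have [->|nef] := eqVneq e f; first by rewrite wedge_dxx !scaler0.
congr (_ *: _).
have sC_neq0 : \sum_e conormal CR e 0 ^+ 2 / x 0 e != 0 by rewrite -sE.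
have Qef : (CR *m invmx (Lambda C x) *m CR^T) e f = - s^-1 * (k e / x 0 e) * (k f / x 0 f).
  rewrite (gram_inv x_neq0 sC_neq0) -sE [LHS]mxE [X in X + _]mxE (negPf nef) mulr0n add0r.
  rewrite [LHS]mxE [X in - X = _]mxE mul_mx_diag [X in - (_ * X) = _]mxE.
  rewrite [X in - (_ * (X * _)) = _]mxE big_ord1 mul_diag_mx [X in - (_ * (X * _ * _)) = _]mxE.
  by rewrite [(_^T)%R _ _]mxE !kE 2![map_mx GRing.inv _ _ _]mxE; ring.
transitivity (CR e a * CR f b * (CR *m invmx (Lambda C x) *m CR^T) e f); last first.
  by rewrite Qef; ring.
rewrite [X in _ = _ * X]mxE mulr_sumr.
under [RHS]eq_bigr => d _ do rewrite [X in _ * (X * _)]mxE mulr_suml mulr_sumr.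
rewrite exchange_big pair_big /=; apply: eq_bigr => -[c d] _ /=.
by rewrite [CR^T _ _]mxE; ring.
Qed.

Lemma phi_graph_coeff : x 0 ord0 = 1 ->
  phi_graph C x [set~ ord0]%SET =
  (n.*2)`!%:R / (2 ^ n * n`!)%:R * (-1) ^+ n * (\prod_e k e) *
  ((\prod_e x 0 e)^-1 * (Num.sqrt (s * \prod_e x 0 e))^-1 * s ^- n).
Proof.
move=> x0; rewrite /phi_graph /phi_form odd_double dXXdX_rank1 ffunE.
have sC_neq0 : \sum_e conormal CR e 0 ^+ 2 / x 0 e != 0 by rewrite -sE.
rewrite (det_gram x_neq0 sC_neq0) -sE.
have -> : ([set~ ord0] = [set lift ord0 i | i : 'I_l])%SET.
  apply/setP => i; rewrite !inE; apply/idP/imsetP => [|[j _ ->]].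
    by case: (unliftP ord0 i) => [j ->|->]; [exists j|rewrite eqxx].
  by rewrite eq_sym neq_lift.
rewrite (pfaffian_rank1 _ (fun (a : 'I_l) (e : 'I_l.+1) => CR e a * (k e / x 0 e)));
  last by move=> i j ij; rewrite /= /bump; lia.
(* Pulling out the factors k_e / x_e for e other than 0 leaves the minor of [C] without row 0, which
   is k_0 since [l] is even. As x_0 = 1, both products then extend over all e. *)
have -> : \det (\matrix_(i, j) (CR (lift ord0 j) i * (k (lift ord0 j) / x 0 (lift ord0 j)))) =
    \prod_e k e * (\prod_e x 0 e)^-1.
  rewrite -det_tr [X in \det X](_ : _ = diag_mx (\row_j (k (lift ord0 j) / x 0 (lift ord0 j)))
      *m row' ord0 CR); last by apply/matrixP => i j; rewrite mul_diag_mx !mxE mulrC.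
  rewrite det_mulmx det_diag [in RHS]big_ord_recl [in X in _ / X]big_ord_recl x0 mul1r.
  have -> : \det (row' ord0 CR) = k ord0.
    by rewrite -kE mxE add0n -signr_odd odd_double mul1r.
  rewrite (eq_bigr (fun i => k (lift ord0 i) * (x 0 (lift ord0 i))^-1)) => [|i _]; last by rewrite mxE.
  by rewrite big_split /= prodfV; ring.
by rewrite /GRing.scale /= -[- s^-1]mulN1r exprMn exprVn; ring.
Qed.
End Density.

(** * Wallis integrals *)

Section ImproperIntegral.
Variable R : realType.
Local Notation mu := (@lebesgue_measure R).
Local Open Scope classical_set_scope.

(** The fundamental theorem applies on the half-lines from 1/(n+1), and monotone convergence
    exhausts the open half-line. Only a limit of [F] at 0+ is required, since [f] may be unbounded
    there. *)
Lemma ge0_continuous_FTC20y (f F : R -> R) (l0 l : R) :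
  (forall x, 0 < x -> 0 <= f x) ->
  (forall x, 0 < x -> {for x, continuous f}) ->
  (forall x : R, 0 < x -> is_derive x 1 F (f x)) ->
  F x @[x --> 0^'+] --> l0 -> F x @[x --> +oo%R] --> l ->
  (\int[mu]_(x in `]0%R, +oo[) (f x)%:E = (l - l0)%:E)%E.
Proof.
move=> f_ge0 f_cont dF F0 Fy.
have mf : measurable_fun (`]0, +oo[%classic : set (measurableTypeR R)) (f : measurableTypeR R -> R).
  apply: open_continuous_measurable_fun => // x; rewrite inE /= in_itv /= andbT.
  exact: f_cont.
pose u (n : nat) : R := n.+1%:R^-1.
have u_gt0 n : 0 < u n by rewrite invr_gt0.
have intE n : (\int[mu]_(x in `[u n, +oo[) (f x)%:E = (l - F (u n))%:E)%E.
  rewrite (@ge0_continuous_FTC2y _ f F _ l) //.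
  - by move=> x ux; apply: f_ge0; exact: lt_le_trans ux.
  - apply: continuous_in_subspaceT => x; rewrite inE /= in_itv /= andbT => ux.
    by apply: f_cont; exact: lt_le_trans ux.
  - by move=> x ux; have [] := dF x (lt_trans (u_gt0 n) ux).
  - apply: cvg_at_right_filter; apply: differentiable_continuous.
    by apply/derivable1_diffP; have [] := dF _ (u_gt0 n).
  - move=> x; rewrite in_itv /= andbT => ux; rewrite derive1E.
    by have [_] := dF x (lt_trans (u_gt0 n) ux).
have setE : `]0%R, +oo[%classic = \bigcup_n `[u n, +oo[%classic.
  apply/seteqP; split=> [x|x [n _]] /=; rewrite !in_itv /= !andbT.
    move=> x0; exists (Num.truncn x^-1) => //=; rewrite in_itv /= andbT /u.
    by rewrite invf_ple ?posrE // ltW // truncnS_gt.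
  exact: lt_le_trans.
have Fu : F (u n) @[n --> \oo] --> l0.
  by apply: (cvg_at_rightP F 0 l0).1 => //; split=> //; exact: cvg_harmonic.
have int_cvg : (\int[mu]_(x in `[u n, +oo[) (f x)%:E)%E @[n --> \oo] --> (l - l0)%:E.
  under eq_fun do rewrite intE.
  by apply: cvg_EFin; [exact: nearW|apply: cvgB => //; exact: cvg_cst].
apply: cvg_unique int_cvg => //; rewrite setE.
apply: ge0_nondecreasing_set_cvg_integral => //.
- move=> m n mn; apply/subsetPset => x /=; rewrite !in_itv /= !andbT; apply: le_trans.
  by rewrite /u lef_pV2 ?posrE // ler_nat.
- move=> n; apply/measurable_EFinP; apply: measurable_funS mf => //.
  by move=> x /=; rewrite !in_itv /= !andbT; exact: lt_le_trans.
- by move=> n x /=; rewrite in_itv /= andbT => /(lt_le_trans (u_gt0 n)) x0; rewrite lee_fin f_ge0.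
Qed.

(** A primitive of sin^n, by the reduction formula that comes from integration by parts. *)
Fixpoint sinX_prim (n : nat) (x : R) : R :=
  match n with
  | 0 => x
  | 1 => - cos x
  | (n'.+1 as m).+1 => (m%:R * sinX_prim n' x - sin x ^+ m * cos x) / m.+1%:R
  end.

(** The integral of sin^n from 0 to pi / 2, see [sinX_prim0_pihalf]. *)
Fixpoint wallis (n : nat) : R :=
  match n with
  | 0 => pi / 2
  | 1 => 1
  | (n'.+1 as m).+1 => m%:R / m.+1%:R * wallis n'
  end.

Lemma nat_ind2 (P : nat -> Prop) :
  P 0%N -> P 1%N -> (forall n, P n -> P n.+1 -> P n.+2) -> forall n, P n.
Proof.
move=> P0 P1 PS n; suff [] : P n /\ P n.+1 by [].
by elim: n => // n [? ?]; split=> //; exact: PS.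
Qed.

Lemma is_derive_sinX_prim n (x : R) : is_derive x 1 (sinX_prim n) (sin x ^+ n).
Proof.
elim/nat_ind2: n => [||n IH _].
- by rewrite expr0; exact: is_derive_id.
- by rewrite expr1; apply: is_derive_eq; rewrite opprK.
- have dm := is_deriveM (is_deriveX n.+1 (is_derive_sin x)) (is_derive_cos x).
  have := is_deriveZ n.+2%:R^-1 (is_deriveB (is_deriveZ n.+1%:R IH) dm).
  rewrite (_ : _ \*: _ = sinX_prim n.+2); last first.
    by apply/funext => y; rewrite !fctE /= /GRing.scale /= mulrC.
  move=> /is_derive_eq; apply; rewrite /GRing.scale exprfctE /= !exprS.
  have N1 : n.+2%:R = n.+1%:R + 1 :> R by rewrite -natr1.
  have N0 : n.+2%:R != 0 :> R by rewrite pnatr_eq0.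
  apply: (mulfI N0); rewrite mulVKf // N1.
  have -> : cos x * (n.+1%:R * (sin x ^+ n) * cos x) =
      n.+1%:R * sin x ^+ n * (1 - sin x ^+ 2) by rewrite -(cos2Dsin2 x); ring.
  by ring.
Qed.

Lemma sinX_prim_cont n : continuous (sinX_prim n).
Proof.
move=> x; apply: differentiable_continuous; apply/derivable1_diffP.
by have [] := is_derive_sinX_prim n x.
Qed.

Lemma sinX_prim0_pihalf n : sinX_prim n (pi / 2) - sinX_prim n 0 = wallis n.
Proof.
elim/nat_ind2: n => [||n IH _] /=.
- by rewrite subr0.
- by rewrite cos_pihalf cos0; ring.
- by rewrite -IH cos_pihalf sin0 expr0n /= mulr0 mul0r !subr0; ring.
Qed.

Lemma wallis_gt0 n : 0 < wallis n.
Proof. by elim/nat_ind2: n => [||n IH _] /=; rewrite ?divr_gt0 ?mulr_gt0 ?pi_gt0 ?invr_gt0. Qed.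

(** By the recursion, (n + 1) W_n W_(n+1) does not depend on n. Working with such pairs avoids
    closed forms that depend on parity. *)
Lemma wallisM n : wallis n * wallis n.+1 = pi / (2 * n.+1%:R).
Proof.
elim: n => [|n IH]; first by rewrite /= !mulr1.
rewrite [wallis n.+2]/=.
have -> : wallis n.+1 * (n.+1%:R / n.+2%:R * wallis n) = (n.+1%:R / n.+2%:R) * (wallis n * wallis n.+1) by ring.
have : n.+1%:R != 0 :> R by rewrite pnatr_eq0.
have : n.+2%:R != 0 :> R by rewrite pnatr_eq0.
rewrite IH; move: (n.+1%:R : R) (n.+2%:R : R) => a b b0 a0.
by field; rewrite a0 b0.
Qed.

Lemma sin_atan (x : R) : sin (atan x) = x / Num.sqrt (1 + x ^+ 2).
Proof.
have c0 : cos (atan x) != 0 by rewrite cos_atan invr_neq0 // gt_eqF // sqrtr_gt0; nra.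
by rewrite -cos_atan -[X in X * _](atanK x) /tan mulfVK.
Qed.

(* With [y = tan t ^ 2 / a] the integrand becomes a power of [sin t]. *)
Lemma integral_wallis (a : R) (n : nat) : 0 < a ->
  (\int[mu]_(y in `]0%R, +oo[)
     ((y * Num.sqrt y)^-1 * Num.sqrt (a + y^-1) ^- n.+2)%:E =
   (2 * wallis n * Num.sqrt a ^- n.+1)%:E)%E.
Proof.
move=> a0; set r := Num.sqrt a; have r0 : 0 < r by rewrite sqrtr_gt0.
pose F (y : R) := (2 * r ^- n.+1) * sinX_prim n (atan (r * Num.sqrt y)).
transitivity (2 * r ^- n.+1 * sinX_prim n (pi / 2) - F 0)%:E; last first.
  congr _%:E; rewrite /F sqrtr0 mulr0 atan0 -sinX_prim0_pihalf; ring.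
apply: (@ge0_continuous_FTC20y _ F).
- move=> y y0; rewrite mulr_ge0 ?invr_ge0 ?exprn_ge0 ?mulr_ge0 ?sqrtr_ge0 // ltW //.
- move=> y y0.
  have y_neq0 : y != 0 by rewrite gt_eqF.
  have cV : {for y, continuous (@GRing.inv R)} by apply: inv_continuous.
  have c1 : {for y, continuous (fun y : R => (y * Num.sqrt y)^-1)}.
    apply: continuousV; first by rewrite mulf_neq0 // gt_eqF // sqrtr_gt0.
    by apply: continuousM => //; exact: sqrt_continuous.
  apply: continuousM => //; apply: continuousV.
    by rewrite expf_neq0 // gt_eqF // sqrtr_gt0 addr_gt0 // invr_gt0.
  have cS : {for y, continuous (fun y : R => a + y^-1)}.
    by apply: continuousD => //; exact: cst_continuous.
  have cQ := continuous_comp cS (@sqrt_continuous R _).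
  exact: (continuous_comp cQ (@exprn_continuous R n.+2 _)).
- move=> y y0; have sy0 : 0 < Num.sqrt y by rewrite sqrtr_gt0.
  have d1 : is_derive y 1 (r \*: Num.sqrt) (r *: (2 * Num.sqrt y)^-1).
    by apply: is_deriveZ; exact: is_derive1_sqrt.
  have d2 := @is_derive1_comp _ atan (r \*: Num.sqrt) y _ _ (is_derive1_atan _) d1.
  have d3 := @is_derive1_comp _ (sinX_prim n) (atan \o (r \*: Num.sqrt)) y _ _
    (is_derive_sinX_prim n _) d2.
  have d4 := is_deriveZ (2 * r ^- n.+1) d3.
  apply: (is_derive_eq d4); rewrite /GRing.scale /= /GRing.scale /= sin_atan.
  (* In terms of the square roots [r], [q], [p] of a, y and 1 + (r q)^2, the claim is an identity of
     rational functions. *)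
  set q := Num.sqrt y; set p := Num.sqrt (1 + _).
  have q0 : 0 < q by [].
  have p0 : 0 < p by rewrite sqrtr_gt0; nra.
  have yE : y = q ^+ 2 by rewrite sqr_sqrtr // ltW.
  have aE : a = r ^+ 2 by rewrite sqr_sqrtr // ltW.
  have pE : 1 + (r * q) ^+ 2 = p ^+ 2 by rewrite sqr_sqrtr //; nra.
  have -> : Num.sqrt (a + y^-1) = p / q.
    rewrite (_ : a + y^-1 = (p / q) ^+ 2) ?sqrtr_sqr ?ger0_norm ?divr_ge0 ?ltW //.
    by rewrite exprMn -pE aE yE; field; rewrite gt_eqF.
  rewrite pE yE !exprMn !exprVn !exprS.
  have : r ^+ n != 0 by rewrite expf_neq0 // gt_eqF.
  have : q ^+ n != 0 by rewrite expf_neq0 // gt_eqF.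
  have : p ^+ n != 0 by rewrite expf_neq0 // gt_eqF.
  move: (r ^+ n) (q ^+ n) (p ^+ n) => A B P P0 B0 A0.
  by field; rewrite P0 B0 A0 !gt_eqF.
- have c1 : {for 0, continuous (fun y : R => r * Num.sqrt y)}.
    by apply: continuousM; [exact: cst_continuous|exact: sqrt_continuous].
  have c2 := continuous_comp (continuous_comp c1 (@continuous_atan R _)) (@sinX_prim_cont n _).
  have cF : {for 0, continuous F} by apply: continuousM => //; exact: cst_continuous.
  exact: cvg_at_right_filter cF.
- apply: cvgM; first exact: cvg_cst.
  apply: (@cvg_comp _ _ _ (fun y => atan (r * Num.sqrt y)) (sinX_prim n) _ (nbhs (pi / 2)));
    last exact: sinX_prim_cont.
  apply: (@cvg_comp _ _ _ (fun y => r * Num.sqrt y) atan _ (pinfty_nbhs R)); last exact: cvgy_atan.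
  apply/cvgryPge => A; near=> y.
  rewrite mulrC -ler_pdivrMr //.
  have [A0|A0] := leP A 0; first by rewrite (le_trans _ (sqrtr_ge0 y)) // mulr_le0_ge0 // invr_ge0 ltW.
  rewrite -[leLHS](ger0_norm (divr_ge0 (ltW A0) (ltW r0))) -sqrtr_sqr.
  apply: ler_wsqrtr.
  by near: y; apply: nbhs_pinfty_ge; rewrite num_real.
Unshelve. all: end_near.
Qed.
End ImproperIntegral.

(** * Integrals over the orthant *)

Section TupleIntegral.
Variable R : realType.
Local Notation mu := (@lebesgue_measure R).
Local Notation T n := (n.-tuple (measurableTypeR R)).
Local Open Scope classical_set_scope.

(** Inversion is continuous only away from 0, so {0} and its complement are treated separately. *)
Lemma measurable_funV d (X : measurableType d) (f : X -> R) :
  measurable_fun setT f -> measurable_fun setT (fun x => (f x)^-1).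
Proof.
move=> mf; apply: (@measurableT_comp _ _ _ _ _ _ (@GRing.inv R)) => //.
rewrite -(setUv [set (0 : R)]); apply/measurable_funU => //.
  exact: measurableC.
split; first exact: measurable_fun_set1.
apply: open_continuous_measurable_fun; first by rewrite openC; exact: closed_eq.
by move=> x; rewrite inE /= => /eqP; exact: inv_continuous.
Qed.

Lemma measurable_fun_sqrt d (X : measurableType d) (f : X -> R) :
  measurable_fun setT f -> measurable_fun setT (fun x => Num.sqrt (f x)).
Proof.
move=> mf; apply: (@measurableT_comp _ _ _ _ _ _ (@Num.sqrt R)) => //.
by apply: continuous_measurable_fun; exact: sqrt_continuous.
Qed.

Lemma measurable_coord n (i : 'I_n) :
  measurable_fun [set: T n] (fun y : T n => tnth y i : R).
Proof. exact: measurable_tnth. Qed.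

(** The density up to a constant, in the absence of self-loops. The parameter [a] stands for the
    part of s independent of [y]: it is 1 in the chart x_0 = 1, and it absorbs the other 1/y_i when
    one variable is integrated. *)
Definition orthant_weight n (a : R) (y : T n) : R :=
  \prod_(i < n) ((tnth y i : R) * Num.sqrt (tnth y i))^-1 *
  Num.sqrt (a + \sum_(i < n) (tnth y i : R)^-1) ^- n.+1.

Lemma measurable_orthant_weight n a : measurable_fun setT (@orthant_weight n a).
Proof.
apply: measurable_funM.
  apply: measurable_prod => i _; apply: measurable_funV.
  apply: measurable_funM; first exact: measurable_coord.
  apply: (@measurable_fun_sqrt _ _ (fun y : T n => tnth y i : R)).
  exact: measurable_coord.
apply: measurable_funV; apply: measurable_funX; apply: measurable_fun_sqrt.
apply: measurable_funD => //; apply: measurable_sum => i.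
apply: (@measurable_funV _ _ (fun y : T n => tnth y i : R)).
exact: measurable_coord.
Qed.

Lemma orthant_weight_ge0 n (a : R) (y : T n) :
  @orthant R n y -> 0 <= orthant_weight a y.
Proof.
move=> y0; apply: mulr_ge0.
  apply: prodr_ge0 => i _; by rewrite invr_ge0 mulr_ge0 ?sqrtr_ge0 // ltW // y0.
by rewrite invr_ge0 exprn_ge0 // sqrtr_ge0.
Qed.

Lemma orthant_weight_cons n (a : R) (x : R) (y : T n) :
  orthant_weight a (tuple_cons (x, y)) =
  \prod_(i < n) ((tnth y i : R) * Num.sqrt (tnth y i))^-1 *
  ((x * Num.sqrt x)^-1 *
   Num.sqrt ((a + \sum_(i < n) (tnth y i : R)^-1) + x^-1) ^- n.+2).
Proof.
rewrite /orthant_weight !big_ord_recl !tnth0.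
rewrite (eq_bigr (fun i : 'I_n => ((tnth y i : R) * Num.sqrt (tnth y i))^-1)); last first.
  by move=> i _; rewrite tnthS.
rewrite [X in a + (_ + X)](eq_bigr (fun i : 'I_n => (tnth y i : R)^-1)); last first.
  by move=> i _; rewrite tnthS.
by rewrite (addrC x^-1) addrA [in RHS]mulrCA !mulrA.
Qed.

Lemma measurable_orthant n : measurable (@orthant R n).
Proof.
rewrite (_ : @orthant R n = \bigcap_(i in [set: 'I_n]) ((fun y : T n => tnth y i) @^-1` `]0%R, +oo[)).
  apply: fin_bigcap_measurable => // i _.
  by rewrite -[X in measurable X]setTI; apply: measurable_tnth.
apply/seteqP; split=> y /=; first by move=> y0 i _ /=; rewrite in_itv /= y0.
by move=> y0 i; have := y0 i Logic.I; rewrite /= in_itv /= andbT.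
Qed.

Lemma preimage_orthant n :
  @tuple_cons R n @^-1` @orthant R n.+1 = `]0%R, +oo[ `*` @orthant R n.
Proof.
apply/seteqP; split=> -[x y] /=; rewrite /orthant /= in_itv /= andbT.
  move=> xy; split; first by have := xy ord0; rewrite tnth0.
  by move=> i; have := xy (lift ord0 i); rewrite tnthS.
by move=> [x0 y0] i; case: (unliftP ord0 i) => [j ->|->]; rewrite ?tnthS ?tnth0.
Qed.

(** Tonelli with the first variable innermost. For fixed [y], [integral_wallis] lowers the exponent
    from n + 2 to n + 1, leaving a multiple of the weight in [n] variables with the same [a]. *)
Lemma integral_orthant_weight n (a : R) : 0 < a ->
  (\int[lebesgue_tuple R n]_(y in @orthant R n) (orthant_weight a y)%:E =
   ((\prod_(j < n) (2 * wallis R j)) / Num.sqrt a)%:E)%E.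
Proof.
elim: n a => [|n IH] a a0.
  rewrite /= integral_dirac; first last.
  - apply/measurable_EFinP/measurable_funTS; exact: measurable_orthant_weight.
  - exact: measurable_orthant.
  rewrite diracE mem_set; last by case.
  by rewrite mul1e /orthant_weight !big_ord0 addr0 !mul1r expr1.
have mw m b : measurable_fun (@orthant R m) (fun y : T m => (orthant_weight b y)%:E).
  by apply/measurable_EFinP/measurable_funTS; exact: measurable_orthant_weight.
(* The measure on tuples is by construction the push-forward of a product measure along
   [tuple_cons]. *)
transitivity (\int[(mu \x lebesgue_tuple R n)%E]_(p in `]0%R, +oo[ `*` @orthant R n)
    (orthant_weight a (tuple_cons p))%:E)%E.
  rewrite -preimage_orthant.
  apply: (ge0_integral_pushforward (@measurable_tuple_cons R n)) => //.
  - exact: measurable_orthant.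
  - exact: mw.
  - by move=> y; rewrite inE lee_fin; exact: orthant_weight_ge0.
rewrite integral_mkcond fubini_tonelli2; last 2 first.
- apply/(measurable_restrictT _ _).1.
  + by apply: measurableX => //; exact: measurable_orthant.
  + apply/measurable_funTS/measurable_EFinP.
    exact: (measurableT_comp (@measurable_orthant_weight n.+1 a) (@measurable_tuple_cons R n)).
- move=> p; rewrite patchE; case: ifPn => // /set_mem; rewrite -preimage_orthant => p0.
  by rewrite lee_fin orthant_weight_ge0.
transitivity (\int[lebesgue_tuple R n]_(y in @orthant R n)
    ((2 * wallis R n)%:E * (orthant_weight a y)%:E))%E.
  rewrite [RHS]integral_mkcond; apply: eq_integral => y _.
  rewrite /fubini_G patchE; case: ifPn => [/set_mem y0|ny].
    transitivity (\int[mu]_(x in `]0%R, +oo[) (orthant_weight a (tuple_cons (x, y)))%:E)%E.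
      rewrite [RHS]integral_mkcond; apply: eq_integral => x _; rewrite !patchE.
      congr (if _ then _ else _); apply/idP/idP => [/set_mem[]|] xy; first by rewrite mem_set.
      by rewrite mem_set //; split => //; exact: set_mem.
    have y_ge0 (i : 'I_n) : 0 <= (tnth y i : R)^-1 by rewrite invr_ge0 ltW // y0.
    under eq_integral => x _ do rewrite orthant_weight_cons EFinM.
    rewrite ge0_integralZl_EFin //.
    - rewrite integral_wallis; last by rewrite ltr_wpDr // sumr_ge0.
      by rewrite -!EFinM /orthant_weight; congr _%:E; ring.
    - move=> x; rewrite /= in_itv /= andbT => x0; rewrite lee_fin; apply: mulr_ge0.
        by rewrite invr_ge0 mulr_ge0 ?sqrtr_ge0 // ltW.
      by rewrite invr_ge0 exprn_ge0 // sqrtr_ge0.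
    - apply/measurable_EFinP/measurable_funTS; apply: measurable_funM.
        apply: measurable_funV; apply: measurable_funM => //; exact: measurable_fun_sqrt.
      apply: measurable_funV; apply: measurable_funX; apply: measurable_fun_sqrt.
      by apply: measurable_funD => //; exact: measurable_funV.
    - by apply: prodr_ge0 => i _; rewrite invr_ge0 mulr_ge0 ?sqrtr_ge0 // ltW // y0.
  rewrite integral0_eq // => x _; rewrite patchE; case: ifPn => // /set_mem[_ /= ?].
  by rewrite mem_set in ny.
rewrite ge0_integralZl_EFin //.
- rewrite IH // -EFinM big_ord_recr /=; congr _%:E; ring.
- exact: measurable_orthant.
- by move=> y y0; rewrite lee_fin orthant_weight_ge0.
- exact: mw.
- by rewrite mulr_ge0 // ltW // wallis_gt0.
Qed.

(** By [wallisM], the factors 2i and 2i + 1 multiply to 2 pi / (2i + 1); the denominators cancel the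
    (2n - 1)!! coming from the Pfaffian. *)
Lemma prod_wallis n :
  (n.*2)`!%:R / (2 ^ n * n`!)%:R * \prod_(j < n.*2) (2 * wallis R j) = (2 * pi) ^+ n.
Proof.
move: (wallis R) (@wallisM R) => W WM.
elim: n => [|n IH]; first by rewrite big_ord0 !mulr1 mulfV ?oner_eq0.
rewrite doubleS !big_ord_recr /= exprSr -IH !factS expnS.
have w2 : 2 * W n.*2 * (2 * W n.*2.+1) = 2 * pi / n.*2.+1%:R.
  have -> : 2 * W n.*2 * (2 * W n.*2.+1) =
    4 * (W n.*2 * W n.*2.+1) by ring.
  have : n.*2.+1%:R != 0 :> R by rewrite pnatr_eq0.
  by rewrite WM; move: (n.*2.+1%:R) => b b0; field.
rewrite -[X in _ * X]mulrA w2 !natrM.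
have : n.*2.+1%:R != 0 :> R by rewrite pnatr_eq0.
have e : (2 * n.+1)%N = n.*2.+2 by rewrite mul2n doubleS.
have : n.+1%:R != 0 :> R by rewrite pnatr_eq0.
have : (2 ^ n)%:R != 0 :> R by rewrite pnatr_eq0 expn_eq0.
have : n`!%:R != 0 :> R by rewrite pnatr_eq0 -lt0n fact_gt0.
have -> : n.*2.+2%:R = 2 * n.+1%:R :> R by rewrite -natrM e.
move: (n.*2.+1%:R : R) (n.+1%:R : R) (n`!%:R : R) ((2 ^ n)%:R : R).
move=> a b c d d0 c0 b0 a0.
by field; rewrite d0 c0 b0 a0.
Qed.
End TupleIntegral.

Lemma phi_graph_coeff_even (R : realType) l (C : 'M[int]_(l.+1, l)) (x : 'rV[R]_l.+1)
    (k := fun e => (conormal C e 0)%:~R : R) (s := \sum_e k e ^+ 2 / x 0 e) :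
  ~~ odd l -> (forall e, 0 < x 0 e) -> s != 0 -> x 0 ord0 = 1 ->
  phi_graph C x [set~ ord0]%SET =
  l`!%:R / (2 ^ l./2 * (l./2)`!)%:R * (-1) ^+ l./2 * (\prod_e k e) *
  ((\prod_e x 0 e)^-1 * (Num.sqrt (s * \prod_e x 0 e))^-1 * s ^- l./2).
Proof.
move=> l_even; rewrite {}/s {}/k; move: (l./2) (even_halfK l_even) => n ln.
by case: l / ln C x l_even => C x _ x_gt0 s_neq0; exact: phi_graph_coeff.
Qed.

(** * The simplex integral when all entries of the conormal vector are 0, 1 or -1 *)

Section Value.
Variables (R : realType) (l : nat) (C : 'M[int]_(l.+1, l)).
Local Notation T := (l.-tuple (measurableTypeR R)).
Let k e : int := conormal C e 0.
Hypothesis k_sqr : forall e, k e ^+ 2 = (k e != 0)%:R.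
Hypothesis k_neq0 : exists e, k e != 0.

Lemma chart0 (y : l.-tuple R) : chart y 0 ord0 = 1.
Proof. by rewrite mxE tnth0. Qed.

Lemma chart_lift (y : l.-tuple R) i : chart y 0 (lift ord0 i) = tnth y i.
Proof. by rewrite mxE tnthS. Qed.

Lemma chart_gt0 (y : T) e : @orthant R l y -> 0 < chart (y : l.-tuple R) 0 e.
Proof.
move=> y0; case: (unliftP ord0 e) => [i ->|->]; last by rewrite chart0.
by rewrite chart_lift; exact: y0.
Qed.

Lemma simplex_density_odd : odd l -> simplex_density C =1 fun _ : T => 0 :> R.
Proof. by move=> ol y; rewrite /simplex_density /phi_graph /phi_form ol ffunE. Qed.

Lemma simplex_densityE (y : T) : ~~ odd l -> @orthant R l y ->
  simplex_density C y = l`!%:R / (2 ^ l./2 * (l./2)`!)%:R * (-1) ^+ l./2 *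
    (\prod_e k e)%:~R * orthant_weight 1 y.
Proof.
move=> ol y0; set x := chart (y : l.-tuple R).
have x0 e : 0 < x 0 e by exact: chart_gt0.
pose s := \sum_e ((k e)%:~R : R) ^+ 2 / x 0 e.
have s_gt0 : 0 < s.
  have [e ke] := k_neq0; rewrite /s (bigD1 e) //= ltr_wpDr //.
    by apply: sumr_ge0 => f _; rewrite divr_ge0 ?sqr_ge0 // ltW.
  by rewrite divr_gt0 // exprn_even_gt0 //= intr_eq0.
have phiE : phi_graph C x [set~ ord0]%SET =
    l`!%:R / (2 ^ l./2 * (l./2)`!)%:R * (-1) ^+ l./2 * (\prod_e (k e)%:~R) *
    ((\prod_e x 0 e)^-1 * (Num.sqrt (s * \prod_e x 0 e))^-1 * s ^- l./2).
  exact: (phi_graph_coeff_even ol x0 (lt0r_neq0 s_gt0) (chart0 _)).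
rewrite /simplex_density phiE.
rewrite rmorph_prod /= -!mulrA; do 3 congr (_ * _).
(* If some k_e is 0, both sides vanish; otherwise all k_e^2 are 1. *)
have [/forallP k0|/forallPn[e /negbNE/eqP ke]] := boolP [forall e, k e != 0]; last first.
  by rewrite (bigD1 e) //= ke !mul0r.
congr (_ * _).
have sE : s = 1 + \sum_(i < l) (tnth y i : R)^-1.
  rewrite /s big_ord_recl /x chart0 divr1 -rmorphXn k_sqr k0; congr (_ + _).
  by apply: eq_bigr => i _; rewrite chart_lift -rmorphXn k_sqr k0 mul1r.
have xE : \prod_e x 0 e = \prod_(i < l) (tnth y i : R).
  rewrite big_ord_recl /x chart0 mul1r; apply: eq_bigr => i _; exact: chart_lift.
have sqrtE : Num.sqrt (\prod_(i < l) (tnth y i : R)) = \prod_(i < l) Num.sqrt (tnth y i : R).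
  rewrite -[RHS]ger0_norm; last by apply: prodr_ge0 => i _; exact: sqrtr_ge0.
  rewrite -sqrtr_sqr -prodrXl; congr Num.sqrt; apply: eq_bigr => i _.
  by rewrite sqr_sqrtr // ltW // y0.
rewrite xE sqrtrM -?sE ?ltW // sqrtE /orthant_weight -sE prodfV big_split /= invfM.
(* The power s^(l/2) from the Pfaffian and the square root of s from the determinant combine to the
   exponent l + 1 in [orthant_weight]. *)
have sl : s ^+ l./2 = Num.sqrt s ^+ l.
  by rewrite -{2}(even_halfK ol) -mul2n exprM sqr_sqrtr ?ltW.
by rewrite sl exprS !invfM; ring.
Qed.

Lemma integrable_orthant_weight :
  (lebesgue_tuple R l).-integrable (@orthant R l) (EFin \o (@orthant_weight R l 1)).
Proof.
apply/integrableP; split.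
  by apply/measurable_EFinP/measurable_funTS; exact: measurable_orthant_weight.
rewrite (eq_integral (fun y : T => (orthant_weight 1 y)%:E)) => [|y /set_mem yo].
  by rewrite integral_orthant_weight // ltry.
by rewrite gee0_abs // lee_fin orthant_weight_ge0.
Qed.

Lemma integrable_simplex_density :
  (lebesgue_tuple R l).-integrable (@orthant R l) (EFin \o (simplex_density C)).
Proof.
have [ol|el] := boolP (odd l).
  rewrite (_ : EFin \o _ = cst 0%E); first exact: integrable0.
  by apply/funext => y; rewrite /= simplex_density_odd.
have := integrableZl (@measurable_orthant R l) (l`!%:R / (2 ^ l./2 * (l./2)`!)%:R *
  (-1) ^+ l./2 * (\prod_e k e)%:~R) integrable_orthant_weight.
apply: eq_integrable => [|y yo]; first exact: measurable_orthant.
by rewrite /= simplex_densityE ?EFinM // -inE.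
Qed.

Lemma integral_simplex_density :
  \int[lebesgue_tuple R l]_(y in @orthant R l) simplex_density C y =
  if odd l then 0 else (- (2 * pi)) ^+ l./2 * (\prod_e k e)%:~R.
Proof.
have [ol|el] := boolP (odd l).
  by rewrite /Rintegral integral0_eq // => y _; rewrite simplex_density_odd.
rewrite (@eq_Rintegral _ _ _ _ _ (fun y => (l`!%:R / (2 ^ l./2 * (l./2)`!)%:R *
  (-1) ^+ l./2 * (\prod_e k e)%:~R) * orthant_weight 1 y)); last first.
  by move=> y yo; rewrite simplex_densityE // -inE.
rewrite RintegralZl //; last 2 first.
- exact: measurable_orthant.
- exact: integrable_orthant_weight.
rewrite /Rintegral integral_orthant_weight //= sqrtr1 divr1 [X in _ = X * _]exprNn.
(* The constants give (2 pi)^(l/2), and the sign (-1)^(l/2) makes it a power of -2 pi. *)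
have := prod_wallis R l./2; rewrite even_halfK // => <-; ring.
Qed.

End Value.

(** * Graphs with two vertices *)

Section Unimodular.
Variables (l : nat) (C : 'M[int]_(l.+1, l)) (P u : 'cV[int]_l.+1).
Hypothesis uP : u^T *m P = 1%:M.
Hypothesis C_span : forall z : 'cV[int]_l.+1,
  u^T *m z = 0 -> exists c : 'cV[int]_l, z = C *m c.

Let border_surj (z : 'cV[int]_l.+1) : exists x, border C P *m x = z.
Proof.
have [c cE] : exists c : 'cV[int]_l, z - P *m (u^T *m z) = C *m c.
  by apply: C_span; rewrite mulmxBr (mulmxA _ P) uP mul1mx subrr.
exists (\col_i if unlift ord_max i is Some i' then c i' 0 else (u^T *m z) 0 0).
rewrite -[RHS](subrK (P *m (u^T *m z))) cE.
apply/matrixP => i j; rewrite ord1 !mxE big_ord_recr /=; congr (_ + _).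
  apply: eq_bigr => k _; rewrite (_ : widen_ord _ k = lift ord_max k).
    by rewrite border_lift mxE liftK.
  by apply/val_inj; rewrite /= /bump leqNgt ltn_ord.
by rewrite border_max mxE unlift_none big_ord1 mxE.
Qed.

(** Every z is P (u^T z) plus an element of the kernel of u^T, which [C] spans. So this integer
    matrix is surjective, has a right inverse, and its determinant is a unit. *)
Lemma det_border_sqr : \det (border C P) ^+ 2 = 1.
Proof.
have /choice[f fE] (j : 'I_l.+1) := border_surj (delta_mx j 0).
have BN : border C P *m (\matrix_(i, j) f j i 0) = 1%:M.
  apply/matrixP => i j; transitivity ((border C P *m f j) i 0).
    by rewrite mxE [RHS]mxE; apply: eq_bigr => e _; rewrite [(\matrix_(_, _) _) _ _]mxE.
  by rewrite fE !mxE eqxx andbT.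
have dN : \det (border C P) * \det (\matrix_(i, j) f j i 0) = 1.
  by rewrite -det_mulmx BN det1.
move: (\det (border C P)) (\det (\matrix_(i, j) f j i 0)) dN => a b ab.
have : a \is a GRing.unit by apply/unitrPr; exists b.
by rewrite qualifE /= => /orP[] /eqP ->.
Qed.

(** The j-th basis vector is u_j P plus a combination of the columns of [C]. Pairing with the
    conormal vector kills [C] and sends [P] to the determinant. *)
Lemma conormalE : (forall c : 'cV[int]_l, u^T *m (C *m c) = 0) ->
  conormal C = \det (border C P) *: u.
Proof.
move=> uC; apply/matrixP => j z; rewrite ord1 {z} [RHS]mxE.
have [c cE] : exists c : 'cV[int]_l, delta_mx j 0 - P *m (u^T *m delta_mx j 0) = C *m c.
  by apply: C_span; rewrite mulmxBr (mulmxA _ P) uP mul1mx subrr.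
have dE (w : 'cV[int]_l.+1) : w^T *m delta_mx j 0 = (w j 0)%:M.
  by rewrite -colE; apply/matrixP => a b; rewrite !ord1 !mxE eqxx mulr1n.
have kC : (conormal C)^T *m C = 0 by rewrite -[LHS]trmxK trmx_mul trmxK conormal_orth trmx0.
have kP : (conormal C)^T *m P = (\det (border C P))%:M.
  apply/matrixP => a b; rewrite !ord1 det_border mxE [RHS]mxE eqxx mulr1n.
  by apply: eq_bigr => e _; rewrite [_^T _ _]mxE mulrC.
have := congr1 (mulmx (conormal C)^T) cE.
rewrite mulmxBr !dE !mulmxA kC mul0mx kP -scalar_mxM => /subr0_eq.
by move=> /matrixP/(_ 0 0); rewrite [LHS]mxE [RHS]mxE eqxx !mulr1n.
Qed.
End Unimodular.

Section Crossing.
Variables (V E H : finType) (G : hgraph V E H).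
Implicit Types (s : {perm V}) (d : directions G) (o : orientation G).

(* For a graph with two vertices, this is 0 on self-loops and otherwise tells
   whether the edge is directed from the first vertex to the second. *)
Definition crossing s d (e : E) : int :=
  \sum_(h | edge_of G h == e)
    (if h == d e then -1 else 1) * (vpos s (inc G h))%:Z.

(** For two vertices and an odd number of edges, the sign relative to the dipole; it is then
    independent of [s] and [d], and 0 if there is a self-loop. *)
Definition graph_sign o s d : int := o s d * \prod_e crossing s d e.

Lemma other_half d e : exists2 h', h' != d e &
  forall h, (edge_of G h == e) = (h == d e) || (h == h').
Proof.
have := edge_of_card G e; rewrite (cardsD1 (d e)) inE tailP eqxx add1n => -[] /eqP.
move=> /cards1P[h' h'E]; exists h'.
  by have := finset.set11 h'; rewrite -h'E !inE => /andP[].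
move=> h; have := congr1 (fun A : {set H} => h \in A) h'E; rewrite /= !inE => <-.
by have [->|] := eqVneq h (d e); rewrite ?tailP ?eqxx.
Qed.

Lemma sum_halves d e (h' : H) (F : H -> int) : h' != d e ->
  (forall h, (edge_of G h == e) = (h == d e) || (h == h')) ->
  \sum_(h | edge_of G h == e) F h = F (d e) + F h'.
Proof.
move=> ne hE; rewrite (bigD1 (d e)) /= ?tailP //; congr (_ + _).
rewrite (bigD1 h') /= ?hE ?eqxx ?orbT ?ne // big1 ?addr0 // => h.
by rewrite hE -andbA -negb_or => /andP[->].
Qed.

Lemma crossingE s d e h' : h' != d e ->
  (forall h, (edge_of G h == e) = (h == d e) || (h == h')) ->
  crossing s d e = (vpos s (inc G h'))%:Z - (vpos s (inc G (d e)))%:Z.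
Proof.
move=> ne hE; rewrite /crossing (sum_halves _ ne hE) eqxx (negPf ne).
by rewrite mulN1r mul1r addrC.
Qed.

Lemma crossing_flip s d d' e :
  crossing s d' e = (if d e != d' e then -1 else 1) * crossing s d e.
Proof.
have [h' ne hE] := other_half d e.
rewrite (crossingE _ ne hE).
have [dd'|dd'] := eqVneq (d e) (d' e); first by rewrite mul1r (@crossingE _ _ _ h') -?dd'.
have d'E : d' e = h'.
  by have := hE (d' e); rewrite tailP eqxx eq_sym (negPf dd') /= => /esym/eqP.
rewrite (@crossingE _ _ _ (d e)) ?d'E //; first by rewrite mulN1r opprB.
  by rewrite eq_sym.
by move=> h; rewrite hE orbC.
Qed.

(** Double counting of half-edges: boundary and coboundary are adjoint. The weight [vpos] produces
    [crossing]; the weight 1 shows that the total boundary is 0. *)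
Lemma sum_bdry (m : nat) d (epos : E -> 'I_m) (w : V -> int) (z : 'cV[int]_m) :
  \sum_v w v * bdry d epos z v =
  \sum_e (\sum_(h | edge_of G h == e)
    (if h == d e then -1 else 1) * w (inc G h)) * z (epos e) 0.
Proof.
transitivity (\sum_h (if h == d (edge_of G h) then -1 else 1) * w (inc G h) *
    z (epos (edge_of G h)) 0).
  rewrite (partition_big (inc G) xpredT) //=; apply: eq_bigr => v _.
  by rewrite mulr_sumr; apply: eq_bigr => h /eqP <-; ring.
rewrite (partition_big (edge_of G) xpredT) //=; apply: eq_bigr => e _.
by rewrite mulr_suml; apply: eq_bigr => h /eqP <-.
Qed.

Lemma sum_bdry_crossing m d (epos : E -> 'I_m) s (z : 'cV[int]_m) :
  \sum_v (vpos s v)%:Z * bdry d epos z v = \sum_e crossing s d e * z (epos e) 0.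
Proof. exact: sum_bdry. Qed.

Lemma sum_bdry0 m d (epos : E -> 'I_m) (z : 'cV[int]_m) :
  \sum_v bdry d epos z v = 0.
Proof.
have := sum_bdry d epos (fun=> 1) z; under eq_bigr => v _ do rewrite mul1r.
move=> ->; rewrite big1 // => e _; have [h' ne hE] := other_half d e.
by rewrite (sum_halves _ ne hE) eqxx (negPf ne) mulN1r mul1r addNr mul0r.
Qed.
End Crossing.

Section TwoVertices.
Variables (V E H : finType) (G : hgraph V E H).
Implicit Types (s : {perm V}) (d : directions G) (o : orientation G).
Hypothesis V2 : #|V| = 2%N.

Lemma vpos_inj s : injective (@vpos V s).
Proof. by move=> v w /enum_rank_inj/perm_inj. Qed.

Lemma two_vertices s : exists v0 v1, [/\ vpos s v0 = 0 :> nat, vpos s v1 = 1 :> nat,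
  v0 != v1 & forall v, (v == v0) || (v == v1)].
Proof.
have ltV i : (i < 2)%N -> (i < #|V|)%N by rewrite V2.
pose v (i : nat) (Hi : (i < 2)%N) := (s^-1)%g (enum_val (Ordinal (ltV i Hi))).
have vE i Hi : vpos s (v i Hi) = i :> nat by rewrite /vpos permKV enum_valK.
exists (v 0 isT), (v 1 isT); split => // [|w].
  by apply/eqP => /(congr1 (fun x => vpos s x : nat)); rewrite !vE.
have : (vpos s w < 2)%N by rewrite -V2.
case E0 : (nat_of_ord (vpos s w)) => [|[|//]] _; apply/orP; [left|right];
  by apply/eqP/(@vpos_inj s)/val_inj; rewrite /= vE.
Qed.

Lemma sum_two (v0 v1 : V) (F : V -> int) : v0 != v1 -> (forall v, (v == v0) || (v == v1)) ->
  \sum_v F v = F v0 + F v1.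
Proof.
move=> v01 vE; rewrite (bigD1 v0) //= (bigD1 v1) /=; last by rewrite eq_sym.
by rewrite big1 ?addr0 // => v /andP[]; have := vE v; case: eqP => //= _ ->.
Qed.

Lemma crossing_sqr s d e : crossing s d e ^+ 2 = (crossing s d e != 0)%:R.
Proof.
have [h' ne hE] := other_half d e; rewrite (crossingE _ ne hE).
have : (vpos s (inc G h') < 2)%N by rewrite -V2.
have : (vpos s (inc G (d e)) < 2)%N by rewrite -V2.
by case: (nat_of_ord (vpos s (inc G h'))) => [|[|//]]; case: (nat_of_ord _) => [|[|//]].
Qed.

(** Two distinct orders of two vertices differ by a transposition, which replaces each position p by
    1 - p. *)
Lemma crossing_order s s' d e :
  crossing s' d e = (-1) ^+ (odd_perm s + odd_perm s')%N * crossing s d e.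
Proof.
have [<-|ss'] := eqVneq s s'; first by case: (odd_perm s); rewrite ?expr2 ?mulrNN !mul1r.
have [v0 [v1 [p0 p1 v01 vE]]] := two_vertices s.
pose t := (s^-1 * s')%g; have s'E : s' = (s * t)%g by rewrite mulKVg.
have tE : t = tperm v0 v1.
  have t01 v : t v = v0 \/ t v = v1 by case/orP: (vE (t v)) => /eqP; [left|right].
  have tv0 : t v0 = v1.
    have [tv0|//] := t01 v0; case/eqP: ss'; rewrite s'E (_ : t = 1%g) ?mulg1 //.
    apply/permP => v; rewrite perm1; case/orP: (vE v) => /eqP-> //.
    by have [/eqP|//] := t01 v1; rewrite -tv0 (inj_eq perm_inj) eq_sym (negPf v01).
  apply/permP => v; case/orP: (vE v) => /eqP->; rewrite ?tpermL ?tpermR //.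
  by have [//|/eqP] := t01 v1; rewrite -{2}tv0 (inj_eq perm_inj) eq_sym (negPf v01).
have posE v : (vpos s' v)%:Z = 1 - (vpos s v)%:Z.
  have : vpos s' v != vpos s v.
    rewrite /vpos (inj_eq enum_rank_inj) s'E permM tE.
    by case/orP: (vE (s v)) => /eqP->; rewrite ?tpermL ?tpermR // eq_sym.
  have : (vpos s v < 2)%N by rewrite -V2.
  have : (vpos s' v < 2)%N by rewrite -V2.
  by rewrite -val_eqE /=; move: (nat_of_ord _) (nat_of_ord _) => [|[|//]] [|[|//]].
have [h' ne hE] := other_half d e; rewrite !(crossingE _ ne hE) !posE.
rewrite s'E odd_permM tE odd_tperm v01; case: (odd_perm s) => /=; ring.
Qed.

(** Flipping an edge negates one crossing and [o]. Exchanging the vertices negates [o] and all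
    crossings, an odd number of them. *)
Lemma graph_sign_indep o s s' d d' : odd #|E| -> graph_sign o s' d' = graph_sign o s d.
Proof.
move=> E_odd; rewrite /graph_sign (ori_change o s s' d d').
have -> : \prod_e crossing s' d' e =
    (-1) ^+ (odd_perm s + odd_perm s' + flips d d')%N * \prod_e crossing s d e.
  under eq_bigr => e _ do rewrite (crossing_flip _ d) (crossing_order s).
  rewrite !big_split /= prodr_const -!exprM exprD mulrCA mulrA; congr (_ * _ * _).
    by rewrite -[LHS]signr_odd oddM -[X in _ && X]/(odd #|E|) E_odd andbT signr_odd.
  rewrite /flips -sum1_card -prodrXr /= [RHS]big_mkcond /=.
  by apply: eq_bigr => e _; rewrite inE; case: (d e != d' e).
by rewrite mulrACA -expr2 sqrr_sign mul1r.
Qed.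

(** The two boundary values add up to 0, and the weight [vpos] extracts the one at the second
    vertex. So H_1 is the kernel of the row of crossings. *)
Lemma bdry_eq0P m d (epos : E -> 'I_m) s (z : 'cV[int]_m) :
  (forall v, bdry d epos z v = 0) <-> \sum_e crossing s d e * z (epos e) 0 = 0.
Proof.
rewrite -sum_bdry_crossing; split=> [bz|]; first by rewrite big1 // => v _; rewrite bz mulr0.
have [v0 [v1 [p0 p1 v01 vE]]] := two_vertices s.
rewrite (sum_two _ v01 vE) p0 p1 mul0r add0r mul1r => b1.
have := sum_bdry0 d epos z; rewrite (sum_two _ v01 vE) b1 addr0 => b0 v.
by case/orP: (vE v) => /eqP->.
Qed.

(** This is the unimodular situation with [u] the vector of crossings: [C] spans its kernel, and the
    arc [P] from the first vertex to the second pairs to 1 with it. *)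
Lemma conormal_presentation l (epos : E -> 'I_l.+1) s d (C : 'M[int]_(l.+1, l)) (P : 'cV[int]_l.+1) :
  bijective epos ->
  (forall z, (forall v, bdry d epos z v = 0) <-> (exists! c : 'cV[int]_l, z = C *m c)) ->
  (forall v, bdry d epos P v = (vpos s v == 1%N :> nat)%:R - (vpos s v == 0%N :> nat)%:R) ->
  \det (border C P) ^+ 2 = 1 /\
  forall e, conormal C (epos e) 0 = \det (border C P) * crossing s d e.
Proof.
move=> [ev eK vK] basis arcs; pose u : 'cV[int]_l.+1 := \col_i crossing s d (ev i).
have uE z : u^T *m z = (\sum_e crossing s d e * z (epos e) 0)%:M.
  apply/matrixP => i j; rewrite !ord1 [RHS]mxE eqxx mulr1n mxE (reindex epos); last first.
    by exists ev => ? _.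
  by apply: eq_bigr => e _; rewrite !mxE eK.
have uP : u^T *m P = 1%:M.
  rewrite uE -sum_bdry_crossing; have [v0 [v1 [p0 p1 v01 vE]]] := two_vertices s.
  by rewrite (sum_two _ v01 vE) !arcs p0 p1.
have span z : u^T *m z = 0 -> exists c : 'cV[int]_l, z = C *m c.
  move=> uz; have /basis[c [-> _]] : forall v, bdry d epos z v = 0; last by exists c.
  apply/(bdry_eq0P d epos s z); move/matrixP/(_ 0 0): uz; rewrite uE !mxE eqxx mulr1n //.
split; first exact: det_border_sqr uP span.
move=> e; rewrite (conormalE uP span) ?mxE ?eK // => c.
rewrite uE (_ : \sum_e _ = 0) ?raddf0 //.
apply/(bdry_eq0P d epos s); apply/basis; exists c; split=> // c' cc'.
(* Unique coordinates of the zero cycle make [C] injective. *)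
have [c0 [c0E c0_uniq]] : exists! c : 'cV[int]_l, 0 = C *m c.
  by apply/basis => v; rewrite /bdry big1 // => h _; rewrite mxE mulr0.
apply/eqP; rewrite -subr_eq0 -(c0_uniq (c - c')) ?(c0_uniq 0) ?mulmx0 //.
by rewrite mulmxBr cc' subrr.
Qed.
End TwoVertices.

(** * The integral of a presentation *)

Section PresentedIntegral.
Variable R : realType.

Lemma simplex_integral_cast m m' l (e : m = m') (C : 'M[int]_(m, l)) :
  simplex_integral R (castmx (e, erefl l) C) = simplex_integral R C.
Proof. by case: m' / e; rewrite castmx_id. Qed.

Lemma simplex_convergent_cast m m' l (e : m = m') (C : 'M[int]_(m, l)) :
  simplex_convergent R (castmx (e, erefl l) C) <-> simplex_convergent R C.
Proof. by case: m' / e; rewrite castmx_id. Qed.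

Lemma det_row_castmx l (e : (l + 1)%N = l.+1) (C : 'M[int]_(l + 1, l)) (P : 'M[int]_(l + 1, 1)) :
  \det (row_mx C P) = \det (border (castmx (e, erefl l) C) (castmx (e, erefl 1%N) P)).
Proof.
rewrite -border_castE.
have gen m m' (f : m = m') (A : 'M[int]_(m, l)) (B : 'M[int]_(m, 1)) :
    row_mx (castmx (f, erefl l) A) (castmx (f, erefl 1%N) B) =
    castmx (f, erefl (l + 1)%N) (row_mx A B).
  by case: m' / f; rewrite !castmx_id.
rewrite gen castmx_comp; move: (row_mx C P) => A.
have det_cast n n' (e1 e2 : n = n') (D : 'M[int]_n) : \det (castmx (e1, e2) D) = \det D.
  by move: e2; case: n' / e1 => e2; rewrite (eq_irrelevance e2 erefl) castmx_id.
by rewrite det_cast.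
Qed.

Variables (V E H : finType) (G : hgraph V E H).

Lemma conormal_presentation_cast m l (f : l.+1 = m) (epos : E -> 'I_m) s
    (d : directions G) (C : 'M[int]_(m, l)) (P : 'cV[int]_m)
    (C' := castmx (esym f, erefl l) C) (P' := castmx (esym f, erefl 1%N) P) :
  #|V| = 2%N -> bijective epos ->
  (forall z, (forall v, bdry d epos z v = 0) <-> (exists! c : 'cV[int]_l, z = C *m c)) ->
  (forall v, bdry d epos P v = (vpos s v == 1%N :> nat)%:R - (vpos s v == 0%N :> nat)%:R) ->
  \det (border C' P') ^+ 2 = 1 /\ exists2 epos' : E -> 'I_l.+1, bijective epos' &
  forall e, conormal C' (epos' e) 0 = \det (border C' P') * crossing s d e.
Proof.
rewrite {}/C' {}/P'; case: m / f epos C P => epos C P V2 epos_bij basis arcs.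
rewrite !castmx_id; have [d1 cE] := conormal_presentation V2 epos_bij basis arcs.
by split=> //; exists epos.
Qed.

(** Here [m] is the dimension of the simplex: its difference from the loop number is |V| - 2. *)
Lemma edges_neq_loopsS (p : presentation G) m : #|V| <> 2%N ->
  (p_loops p + p_rank p)%N = m.+1 -> p_loops p <> m.
Proof. by have := p_card p => -> V2 lk lm; apply: V2; congr S; lia. Qed.

Lemma simplex_convergent_other (p : presentation G) :
  #|V| <> 2%N -> simplex_convergent R (p_cycles p).
Proof.
move=> /(@edges_neq_loopsS p); move: (p_cycles p).
by case: (p_loops p + p_rank p)%N => // m C /(_ m erefl) lm /lm.
Qed.

Lemma presented_integral_other (o : orientation G) (p : presentation G) :
  #|V| <> 2%N -> presented_integral R o p = 0.
Proof.
move=> V2; rewrite /presented_integral /graph_integral_basis.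
suff -> : simplex_integral R (p_cycles p) = 0 by rewrite !mulr0.
have := fun m => @edges_neq_loopsS p m V2; move: (p_cycles p).
by case: (p_loops p + p_rank p)%N => // m C /(_ m erefl) /eqP/negPf lm /=; rewrite lm.
Qed.

(** The presentation enters through the determinant [D] = 1 or -1, once in [p_sign] and once in each
    of the l + 1 entries of the conormal vector. For even [l] these l + 2 signs cancel; for odd [l]
    the form is 0. *)
Lemma presentation_rank1 (p : presentation G) (o : orientation G) : #|V| = 2%N ->
  simplex_convergent R (p_cycles p) /\
  presented_integral R o p =
    if odd #|E| then (graph_sign o (p_order p) (p_dir p))%:~R else 0.
Proof.
move=> V2; rewrite /presented_integral /graph_integral_basis /p_sign.
case: p => l k s d epos C P card epos_bij basis arcs /=.
have k1 : k = 1%N by move: card; rewrite V2 => -[].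
move: k k1 epos C P card epos_bij basis arcs => _ -> epos C P card epos_bij basis arcs.
pose e := esym (esym (addn1 l)); rewrite (det_row_castmx e) -(simplex_integral_cast e).
rewrite -(simplex_convergent_cast e).
have arcs0 v : bdry d epos P v = (vpos s v == 1%N :> nat)%:R - (vpos s v == 0%N :> nat)%:R.
  by rewrite -(arcs ord0) (_ : col ord0 P = P) //; apply/matrixP => i j; rewrite !ord1 mxE.
have [dd [epos' epos'_bij cE]] := conormal_presentation_cast (esym (addn1 l)) V2 epos_bij basis arcs0.
rewrite -/e in dd cE; set D := \det _ in dd cE *; set C' := castmx _ C in cE *.
have cardE : #|E| = l.+1 by rewrite (bij_eq_card epos'_bij) card_ord.
have [ev eK vK] := epos'_bij.
have cE' i : conormal C' i 0 = D * crossing s d (ev i) by rewrite -cE vK.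
have D0 : D != 0 by apply/eqP => D0; move: dd; rewrite D0.
have k_sqr i : conormal C' i 0 ^+ 2 = (conormal C' i 0 != 0)%:R.
  by rewrite cE' exprMn dd mul1r crossing_sqr // mulf_eq0 (negPf D0).
have k_neq0 : exists i, conormal C' i 0 != 0.
  have [v0 [v1 [p0 p1 v01 vE]]] := two_vertices V2 s.
  (* If all crossings vanished, every chain would be a cycle, but the arc [P] has boundary 1 at the
     second vertex. *)
  apply/existsP; apply: contraT; rewrite negb_exists => /forallP c0.
  have : bdry d epos P v1 = 0.
    apply: (bdry_eq0P V2 d epos s P).2 => //; apply: big1 => x _.
    have /negbNE := c0 (epos' x); rewrite cE mulf_eq0 (negPf D0) /= => /eqP->.
    by rewrite mul0r.
  by rewrite arcs0 p1.
split; first by move=> _; exact: integrable_simplex_density.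
rewrite /simplex_integral eqxx integral_simplex_density // cardE /=.
case: ifPn => [ol|el]; first by rewrite !mulr0.
have prodE : \prod_i conormal C' i 0 = D * \prod_x crossing s d x.
  rewrite (reindex epos') /=; last by exists ev => ? _.
  under eq_bigr => x _ do rewrite cE.
  rewrite big_split /= prodr_const; congr (_ * _).
  rewrite -[#|_|]/(#|E|) cardE exprS -(even_halfK el) -muln2 mulnC exprM dd expr1n mulr1 //.
rewrite prodE /graph_sign [RHS]intrM !intrM mulKf; last first.
  by rewrite expf_neq0 // oppr_eq0 mulf_neq0 ?pnatr_eq0 // gt_eqF // pi_gt0.
have D1 : (D%:~R : R) ^+ 2 = 1 by rewrite -rmorphXn dd.
transitivity ((D%:~R : R) ^+ 2 * ((o s d)%:~R * (\prod_x crossing s d x)%:~R)); first by ring.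
by rewrite D1 mul1r.
Qed.
End PresentedIntegral.

(** * Existence of presentations *)

(* By the Smith normal form of [P], the columns of [P] extend to a basis. *)
Lemma split_kernel_basis k l (P : 'M[int]_(l + k, k)) (b : 'M[int]_(k, l + k)) :
  b *m P = 1%:M ->
  exists C : 'M[int]_(l + k, l), forall z : 'cV[int]_(l + k),
    b *m z = 0 <-> exists! c : 'cV[int]_l, z = C *m c.
Proof.
move=> bP; have [L uL [S uS [dd _ PE]]] := int_Smith_normal_form P.
set D := (\matrix_(_, _) _) in PE.
(* [I1] and [I2] include the first [k] and the last [l] coordinates. *)
pose I1 : 'M[int]_(l + k, k) := \matrix_(i, j) (i == j :> nat)%:R.
pose I2 : 'M[int]_(l + k, l) := \matrix_(i, j) (i == j + k :> nat)%N%:R.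
pose dg : 'rV[int]_k := \row_j dd`_j.
have DE : D = I1 *m diag_mx dg.
  apply/matrixP => i j; rewrite mul_mx_diag !mxE.
  by case: eqP => [->|]; rewrite ?mul1r ?mul0r // mulr0n.
(* As [b *m P] is the identity, the diagonal factor is invertible over the integers, so [P] and
   [L *m I1] have the same image. *)
have DN : (S *m b *m L *m I1) *m diag_mx dg = 1%:M.
  have := congr1 (fun A => S *m A *m invmx S) bP; rewrite /= mulmx1 mulmxV // PE DE.
  by move=> <-; rewrite -!mulmxA mulmxV // mulmx1.
have ND : diag_mx dg *m (S *m b *m L *m I1) = 1%:M by exact: mulmx1C DN.
have I12 (z : 'cV[int]_(l + k)) : exists a c, z = I1 *m a + I2 *m c.
  have ltk (i : 'I_k) : (i < l + k)%N by rewrite ltn_addl.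
  have ltl (i : 'I_l) : (i + k < l + k)%N by rewrite ltn_add2r.
  exists (\col_i z (Ordinal (ltk i)) 0), (\col_i z (Ordinal (ltl i)) 0).
  apply/matrixP => i j; rewrite ord1 {j} !mxE.
  have [ik|ki] := ltnP i k.
    rewrite (bigD1 (Ordinal ik)) //= !mxE eqxx mul1r !big1 ?addr0.
    - by congr (z _ _); exact/val_inj.
    - by move=> j _; rewrite !mxE; case: eqP => [ij|]; rewrite ?mul0r //; lia.
    - move=> j; rewrite -val_eqE /= => /eqP ji; rewrite !mxE.
      by case: eqP => [ij|]; rewrite ?mul0r //; lia.
  have il : (i - k < l)%N by have := ltn_ord i; lia.
  rewrite big1 ?add0r; last first.
    by move=> j _; rewrite !mxE; case: eqP => [ij|]; rewrite ?mul0r //; have := ltn_ord j; lia.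
  rewrite (bigD1 (Ordinal il)) //= !mxE big1 ?addr0.
    have -> : (i == (Ordinal il + k)%N :> nat) = true by apply/eqP; rewrite /= subnK.
    by rewrite mul1r; congr (z _ _); apply/val_inj; rewrite /= subnK.
  move=> j; rewrite -val_eqE /= => /eqP ji; rewrite !mxE.
  by case: eqP => [ij|]; rewrite ?mul0r //; lia.
have I2_inj (c : 'cV[int]_l) a : I2 *m c = I1 *m a -> c = 0.
  have ltl (i : 'I_l) : (i + k < l + k)%N by rewrite ltn_add2r.
  move=> /matrixP E; apply/matrixP => i j; rewrite ord1 [RHS]mxE.
  have := E (Ordinal (ltl i)) 0; rewrite !mxE (bigD1 i) //= !mxE eqxx mul1r !big1 ?addr0 //.
    by move=> x _; rewrite !mxE; case: eqP => /= [ij|]; rewrite ?mul0r //; have := ltn_ord x; lia.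
  move=> x; rewrite -val_eqE /= => /eqP ji; rewrite !mxE.
  by case: eqP => /= [ij|]; rewrite ?mul0r //; lia.
(* The projection onto the kernel of [b] along the image of [P]; it turns the last [l] columns of
   [L] into a basis of that kernel. *)
pose Q := 1%:M - P *m b.
have QP : Q *m P = 0 by rewrite mulmxBl mul1mx -mulmxA bP mulmx1 subrr.
have bQ : b *m Q = 0 by rewrite mulmxBr mulmx1 mulmxA bP mul1mx subrr.
have QLI1 : Q *m (L *m I1) = 0.
  have <- : P *m (invmx S *m (S *m b *m L *m I1)) = L *m I1.
    move: (S *m b *m L *m I1) ND => N ND.
    by rewrite PE DE -!mulmxA mulKVmx // ND mulmx1.
  by rewrite mulmxA QP mul0mx.
exists (Q *m L *m I2) => z; split=> [bz|[c [-> _]]]; last by rewrite !mulmxA bQ !mul0mx.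
have Qz : Q *m z = z by rewrite mulmxBl mul1mx -mulmxA bz mulmx0 subr0.
have [a [c zE]] := I12 (invmx L *m z).
have zE2 : z = Q *m L *m I2 *m c.
  rewrite -{1}Qz -{1}(mulKVmx uL z) zE mulmxDr mulmxDr mulmxA mulmxA -(mulmxA Q) QLI1.
  by rewrite mul0mx add0r !mulmxA.
exists c; split=> // c' zE'.
(* A combination of the last columns of [L] killed by [Q] lies in the image of [P], hence in the
   span of the first [k] columns, and so is trivial. *)
have : Q *m (L *m (I2 *m (c - c'))) = 0 by rewrite !mulmxA !mulmxBr -zE2 -zE' subrr.
rewrite mulmxBl mul1mx => /subr0_eq; rewrite -mulmxA {1}PE DE -!mulmxA.
move=> /(congr1 (mulmx (invmx L))); rewrite !mulKmx // => /I2_inj/subr0_eq; exact.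
Qed.

Section Existence.
Variables (V E H : finType) (G : hgraph V E H) (d : directions G).
Hypothesis G_connected : gconnected G.

Lemma bdryD m (epos : E -> 'I_m) (z z' : 'cV[int]_m) v :
  bdry d epos (z + z') v = bdry d epos z v + bdry d epos z' v.
Proof. by rewrite -big_split; apply: eq_bigr => h _; rewrite mxE mulrDr. Qed.

Lemma bdryN m (epos : E -> 'I_m) (z : 'cV[int]_m) v :
  bdry d epos (- z) v = - bdry d epos z v.
Proof. by rewrite -sumrN; apply: eq_bigr => h _; rewrite mxE mulrN. Qed.

(** Induction along a path: each step adds one edge, with a sign according to its direction. *)
Lemma arc_exists m (epos : E -> 'I_m) (v w : V) : bijective epos ->
  exists z : 'cV[int]_m, forall x, bdry d epos z x = (x == w)%:R - (x == v)%:R.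
Proof.
move=> [ev eK vK].
have [_ /forallP/(_ v)/forallP/(_ w)/connectP[p]] := andP G_connected.
elim: p v => [|y p IH] v /=.
  by move=> _ ->; exists 0 => x; rewrite subrr /bdry big1 // => h _; rewrite mxE mulr0.
move=> /andP[vy yp] wE; have [z zE] := IH y yp wE.
suff [z' z'E] : exists z' : 'cV[int]_m, forall x, bdry d epos z' x = (x == y)%:R - (x == v)%:R.
  by exists (z + z') => x; rewrite bdryD zE z'E; ring.
have [h /existsP[h' /and3P[/eqP eh /eqP <- /eqP <-]]] := existsP vy.
(* [adj] also relates a vertex to itself through a single half-edge; the zero chain serves for such
   a step. *)
have [hh'|hh'] := eqVneq h h'.
  by exists 0 => x; rewrite hh' subrr /bdry big1 // => h0 _; rewrite mxE mulr0.
have [h1 ne hE] := other_half d (edge_of G h).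
have dE x : bdry d epos (delta_mx (epos (edge_of G h)) 0) x =
    (x == inc G h1)%:R - (x == inc G (d (edge_of G h)))%:R.
  rewrite /bdry big_mkcond /= (bigID (fun h0 => edge_of G h0 == edge_of G h)) /=.
  rewrite [X in _ + X]big1 ?addr0; last first.
    move=> h0 h0N; rewrite mxE (inj_eq (can_inj eK)) (negPf h0N) mulr0; by case: ifP.
  rewrite (sum_halves _ ne hE) !mxE tailP !eqxx (eqP (_ : edge_of G h1 == edge_of G h)); last first.
    by rewrite hE eqxx orbT.
  rewrite (negPf ne) !eqxx !(eq_sym x).
  by case: (inc G h1 == x); case: (inc G (d _) == x); rewrite /= ?mulr1.
have := hE h; have := hE h'; rewrite -eh !eqxx => /esym/orP[] /eqP h'E /esym/orP[] /eqP hE'.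
- by case/eqP: hh'; exact: etrans hE' (esym h'E).
- by exists (- delta_mx (epos (edge_of G h)) 0) => x; rewrite bdryN dE -hE' -h'E opprB.
- by exists (delta_mx (epos (edge_of G h)) 0) => x; rewrite dE -hE' -h'E.
- by case/eqP: hh'; exact: etrans hE' (esym h'E).
Qed.

(** [beta] is the boundary map without the first vertex, where the value is forced by the zero sum.
    Arcs from that vertex form a right inverse of [beta], and [split_kernel_basis] provides the
    cycles. *)
Lemma presentation_exists : inhabited (presentation G).
Proof.
have [V0 _] := andP G_connected.
pose k := #|V|.-1; have cardV : #|V| = k.+1 by rewrite prednK.
pose vtx (i : nat) (Hi : (i < k.+1)%N) : V := enum_val (cast_ord (esym cardV) (Ordinal Hi)).
have vtxE i Hi : vpos 1%g (vtx i Hi) = i :> nat by rewrite /vpos perm1 enum_valK.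
pose vS (i : 'I_k) := vtx i.+1 (ltn_ord i : (i.+1 < k.+1)%N).
have vpos_eq v w : (vpos 1%g v == vpos 1%g w :> nat) = (v == w).
  by rewrite (inj_eq val_inj) (inj_eq (@vpos_inj _ _)).
pose beta m (epos : E -> 'I_m) : 'M[int]_(k, m) :=
  \matrix_(i, e) bdry d epos (delta_mx e 0) (vS i).
have betaE m (epos : E -> 'I_m) (z : 'cV[int]_m) i : (beta m epos *m z) i 0 = bdry d epos z (vS i).
  rewrite mxE; under eq_bigr => e _ do rewrite mxE mulr_suml.
  rewrite exchange_big; apply: eq_bigr => h _ /=.
  rewrite (bigD1 (epos (edge_of G h))) //= big1 ?addr0 => [|e /negPf ne].
    by rewrite mxE !eqxx mulr1.
  by rewrite mxE [epos _ == e]eq_sym ne mulr0 mul0r.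
have beta_eq0 m (epos : E -> 'I_m) (z : 'cV[int]_m) :
    beta m epos *m z = 0 <-> forall v, bdry d epos z v = 0.
  split=> [bz|bz]; last by apply/matrixP => i j; rewrite ord1 betaE bz mxE.
  have bS v : v != vtx 0 isT -> bdry d epos z v = 0.
    rewrite -vpos_eq vtxE; case vE : (nat_of_ord (vpos 1%g v)) => [|i] // _.
    have ik : (i < k)%N by have := ltn_ord (vpos 1%g v); rewrite vE cardV ltnS.
    have -> : v = vS (Ordinal ik) by apply/eqP; rewrite -vpos_eq vtxE vE.
    by rewrite -betaE bz mxE.
  move=> v; have [->|/bS //] := eqVneq v (vtx 0 isT).
  have := sum_bdry0 d epos z; rewrite (bigD1 (vtx 0 isT)) //= big1 ?addr0 //.
have arcs m (epos : E -> 'I_m) : bijective epos -> exists2 P : 'M[int]_(m, k),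
    beta m epos *m P = 1%:M & forall i v, bdry d epos (col i P) v =
      (vpos 1%g v == i.+1 :> nat)%:R - (vpos 1%g v == 0 :> nat)%:R.
  move=> epos_bij.
  have /choice[f fE] (i : 'I_k) := @arc_exists m epos (vtx 0 isT) (vS i) epos_bij.
  have colE i : col i (\matrix_(e, i) f i e 0) = f i.
    by apply/matrixP => a j; rewrite ord1 !mxE.
  exists (\matrix_(e, i) f i e 0) => [|i v]; last by rewrite colE fE -!vpos_eq !vtxE.
  apply/matrixP => i j; rewrite -[LHS](_ : (beta m epos *m f j) i 0 = _).
    by rewrite betaE fE -!vpos_eq !vtxE eqSS subr0 mxE val_eqE; case: (i == j).
  by rewrite mxE [RHS]mxE; apply: eq_bigr => e _; congr (_ * _); rewrite mxE.
(* A right inverse for some numbering of the edges gives k <= |E|, needed to write |E| as l + k. *)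
have [P0 /mulmx1_min kE _] := arcs #|E| enum_rank (@enum_rank_bij E).
pose l := (#|E| - k)%N; have lk : #|E| = (l + k)%N by rewrite subnK.
pose epos e := cast_ord lk (enum_rank e).
have epos_bij : bijective epos.
  apply: bij_comp (@enum_rank_bij E); exists (cast_ord (esym lk)).
  - exact: cast_ordK.
  - exact: cast_ordKV.
have [P bP PE] := arcs _ _ epos_bij; have [C CE] := split_kernel_basis bP.
constructor; refine (@Presentation _ _ _ G l k 1%g d epos C P cardV epos_bij _ PE).
by move=> z; split=> [/beta_eq0/CE|/CE/beta_eq0].
Qed.
End Existence.

(** * Dipoles *)

Section Directions.
Variables (V E H : finType) (G : hgraph V E H).

Lemma half_exists e : exists h, edge_of G h == e.
Proof.
have /card_gt0P[h] : (0 < #|[set h | edge_of G h == e]|)%N by rewrite edge_of_card.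
by rewrite inE; exists h.
Qed.

Definition some_dir : directions G :=
  Directions (fun e => eqP (xchooseP (half_exists e))).
End Directions.

Lemma graph_sign_iso (V E H V' E' H' : finType) (G : hgraph V E H) (G' : hgraph V' E' H')
    (phi : giso G G') o o' s d : is_push phi o o' ->
  exists s' d', graph_sign o' s' d' = graph_sign o s d.
Proof.
move=> push; have [gv vK kv] := iso_v_bij phi; have [ge eK ke] := iso_e_bij phi.
have [gh hK kh] := iso_h_bij phi.
have cV : #|V| = #|V'| := bij_eq_card (iso_v_bij phi).
pose f v' := enum_val (cast_ord cV (enum_rank (s (gv v')))).
have f_inj : injective f.
  by move=> x y /enum_val_inj/cast_ord_inj/enum_rank_inj/perm_inj/(can_inj kv).
have tP e' : edge_of G' (iso_h phi (d (ge e'))) = e' by rewrite iso_edge_of tailP ke.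
exists (perm f_inj), (Directions tP).
have posE v : vpos (perm f_inj) (iso_v phi v) = vpos s v :> nat.
  by rewrite /vpos permE enum_valK /= vK.
have dirE e : Directions tP (iso_e phi e) = iso_h phi (d e) by rewrite /= eK.
rewrite /graph_sign (push _ _ _ _ posE dirE); congr (_ * _).
rewrite (reindex (iso_e phi)) /=; last by apply: onW_bij; exact: iso_e_bij.
apply: eq_bigr => e _; rewrite /crossing.
rewrite (reindex (iso_h phi)) /=; last by apply: onW_bij; exact: iso_h_bij.
apply: eq_big => [h|h _]; first by rewrite iso_edge_of (inj_eq (can_inj eK)).
by rewrite iso_inc posE eK (inj_eq (can_inj hK)).
Qed.

(** The order and the directions are arbitrary choices. With an even number of edges a nonzero sign
    would depend on the order, hence the value 0. *)
Definition ograph_sign (g : ograph) : rat :=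
  if (nv g == 2%N) && odd (ne g) then
    (graph_sign (ograph_ori g) 1%g (some_dir (ugraph g)))%:~R
  else 0.

Lemma ograph_signE g s d : nv g = 2%N -> odd (ne g) ->
  ograph_sign g = (graph_sign (ograph_ori g) s d)%:~R.
Proof.
move=> g2 g_odd; rewrite /ograph_sign.
have -> : (nv g == 2%N) && odd (ne g) = true by rewrite g2 eqxx g_odd.
by congr _%:~R; apply: graph_sign_indep; rewrite card_ord.
Qed.

Lemma ograph_sign_compat : gc_compat ograph_sign.
Proof.
split=> [g g' phi push|g]; last first.
  rewrite /ograph_sign /=; case: ifP; rewrite ?oppr0 // => _.
  by rewrite -mulrNz /graph_sign -mulNr.
have := bij_eq_card (iso_v_bij phi); rewrite !card_ord => ev.
have := bij_eq_card (iso_e_bij phi); rewrite !card_ord => ee.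
have [/andP[/eqP g2 g_odd]|ng] := boolP ((nv g == 2%N) && odd (ne g)); last first.
  have ng' : ~~ ((nv g' == 2%N) && odd (ne g')) by rewrite -ev -ee.
  by rewrite /ograph_sign (negPf ng) (negPf ng').
rewrite (ograph_signE 1%g (some_dir (ugraph g))) //.
have [s' [d' <-]] := graph_sign_iso 1%g (some_dir (ugraph g)) push.
by rewrite (ograph_signE s' d') // -?ev -?ee.
Qed.

Lemma vpos1_ord n (i : 'I_n) : vpos 1%g i = i :> nat.
Proof. by rewrite /vpos perm1 enum_rank_ord. Qed.

Section DipoleSign.
Variables (m : nat) (m_ge3 : (2 < m)%N).

Definition dip_half (v : 'I_2) (e : 'I_m) : 'I_(m + m) :=
  if v == ord0 then lshift m e else rshift m e.

Lemma ord2P (v : 'I_2) : v = ord0 \/ v = ord_max.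
Proof. by case: v => [[|[|//]] ?]; [left|right]; exact/val_inj. Qed.

Lemma dip_edge_half v e : dip_edge (dip_half v e) = e.
Proof. by rewrite /dip_half; case: ifP; rewrite ?dip_edge_l ?dip_edge_r. Qed.

Lemma dip_inc_half v e : dip_inc (dip_half v e) = v.
Proof. by have [->|->] := ord2P v; rewrite /dip_half /= ?dip_inc_l ?dip_inc_r. Qed.

Lemma dip_halfK h : dip_half (dip_inc h) (dip_edge h) = h.
Proof.
rewrite -[h]splitK; case: fintype.split => e /=.
  by rewrite dip_inc_l dip_edge_l.
by rewrite dip_inc_r dip_edge_r.
Qed.

(** A half-edge of the dipole is determined by its vertex and its edge, so automorphisms correspond
    to arbitrary pairs of permutations of vertices and edges. *)
Lemma card_aut_dipole : card_aut (dipole_graph m) = (2 * m`!)%N.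
Proof.
pose f (ab : {perm 'I_2} * {perm 'I_m}) h := dip_half (ab.1 (dip_inc h)) (ab.2 (dip_edge h)).
have f_inj ab : injective (f ab).
  move=> h h' hh'; rewrite -[h]dip_halfK -[h']dip_halfK.
  have /perm_inj -> : ab.1 (dip_inc h) = ab.1 (dip_inc h').
    by have := congr1 (@dip_inc m) hh'; rewrite !dip_inc_half.
  have /perm_inj -> // : ab.2 (dip_edge h) = ab.2 (dip_edge h').
  by have := congr1 (@dip_edge m) hh'; rewrite !dip_edge_half.
pose F ab := (ab, perm (@f_inj ab)) : {perm 'I_2} * {perm 'I_m} * {perm 'I_(m + m)}.
rewrite /card_aut (_ : [set t | _] = [set F ab | ab : {perm 'I_2} * {perm 'I_m}]%SET).
  rewrite card_imset; last by move=> x y [].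
  by rewrite card_prod !card_Sn.
apply/setP => -[ab c]; rewrite inE; apply/forallP/imsetP => [ac|[ab' _ [-> ->]] h]; last first.
  by rewrite /= permE /f dip_edge_half dip_inc_half !eqxx.
exists ab => //; congr (_, _); apply/permP => h; rewrite permE /f.
by have /andP[/eqP <- /eqP <-] := ac h; rewrite dip_halfK.
Qed.

Lemma ograph_sign_dipole : odd m -> ograph_sign (dipole m_ge3) = 1.
Proof.
move=> m_odd; rewrite (@ograph_signE (dipole m_ge3) 1%g (dipole_dir m)) // /graph_sign.
rewrite [ograph_ori _ _ _]/(std_ori _ _ _ _) /std_ori odd_perm1 /flips.
rewrite (_ : [set e | _] = finset.set0) ?cards0; last first.
  by apply/setP => e; rewrite !inE eqxx.
rewrite mul1r big1 // => e _; rewrite (@crossingE _ _ _ _ _ _ _ (rshift m e)).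
- by rewrite !vpos1_ord /= dip_inc_l dip_inc_r.
- by rewrite /= eq_rlshift.
- move=> h; rewrite -[h]dip_halfK /= dip_edge_half /dip_half.
  by case: ifP => _; rewrite ?eq_lshift ?eq_rshift ?eq_lrshift ?eq_rlshift ?orbF.
Qed.

(** The linear extension of [ograph_sign] takes the value 1 on this class. *)
Lemma gc_class_dipole_neq0 : odd m -> gc_class (dipole m_ge3) != 0.
Proof.
move=> m_odd; apply/eqP => c0; have := gc_extP ograph_sign_compat (dipole m_ge3).
rewrite c0 ograph_sign_dipole // -[X in gc_ext _ X](subrr (0 : GC3)) -scaleN1r addrC.
rewrite (gc_ext_linear ograph_sign_compat) => /eqP; rewrite mulN1r addNr eq_sym oner_eq0 //.
Qed.
End DipoleSign.

(** An edge with nonzero crossing has a half at the first vertex; that half becomes its tail. *)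
Lemma directed_crossing (V E H : finType) (G : hgraph V E H) s d :
  #|V| = 2%N -> (forall e, crossing (G := G) s d e != 0) ->
  exists d' : directions G, forall e, crossing s d' e = 1.
Proof.
move=> V2 cross.
have /choice[t tP] (e : E) : exists h, edge_of G h = e /\ vpos s (inc G h) = 0 :> nat.
  have [h' ne hE] := other_half d e; move: (cross e); rewrite (crossingE _ ne hE).
  have : (vpos s (inc G h') < 2)%N by rewrite -V2.
  have : (vpos s (inc G (d e)) < 2)%N by rewrite -V2.
  have [d0 _ _|d1 dlt hlt] := eqVneq (vpos s (inc G (d e)) : nat) 0%N.
    by exists (d e); rewrite tailP.
  have [h0|h1] := eqVneq (vpos s (inc G h') : nat) 0%N.
    by exists h'; split=> //; apply/eqP; rewrite hE eqxx orbT.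
  by rewrite subr_eq0 eqz_nat => /eqP []; lia.
have tE e : edge_of G (t e) = e by have [] := tP e.
exists (Directions tE) => e.
have := cross e; rewrite (crossing_flip _ (Directions tE)) mulf_eq0 negb_or => /andP[_].
have [h' ne hE] := other_half (Directions tE) e; rewrite (crossingE _ ne hE) /=.
have [_ ->] := tP e; rewrite subr0.
have : (vpos s (inc G h') < 2)%N by rewrite -V2.
by case: (nat_of_ord _) => [|[|//]].
Qed.

Section ToDipole.
Variables (m nh : nat) (G : hgraph 'I_2 'I_m 'I_nh) (d : directions G).
Hypothesis d_cross : forall e, crossing 1%g d e = 1.

Let tail_head e : exists2 h', h' != d e & [/\ edge_of G h' = e,
  inc G (d e) = ord0, inc G h' = ord_max &
  forall h, edge_of G h = e -> h = d e \/ h = h'].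
Proof.
have [h' ne hE] := other_half d e; exists h' => //.
have := d_cross e; rewrite (crossingE _ ne hE) !vpos1_ord.
have [-> | ->] := ord2P (inc G (d e)); have [-> | ->] := ord2P (inc G h') => //= _.
split=> // [|h /eqP]; first by apply/eqP; rewrite hE eqxx orbT.
by rewrite hE => /orP[] /eqP; [left|right].
Qed.

Let to_dip (h : 'I_nh) : 'I_(m + m) := dip_half (inc G h) (edge_of G h).

Let to_dip_bij : bijective to_dip.
Proof.
pose of_dip (k : 'I_(m + m)) : 'I_nh :=
  odflt (d (dip_edge k)) [pick h | to_dip h == k].
have to_dip_surj k : exists h, to_dip h == k.
  have [h' _ [eh' i0 i1 _]] := tail_head (dip_edge k).
  rewrite /to_dip -[k]dip_halfK; have [->|->] := ord2P (dip_inc k).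
    by exists (d (dip_edge k)); rewrite i0 tailP.
  by exists h'; rewrite i1 eh'.
have to_dip_inj : injective to_dip.
  move=> h1 h2 E12.
  have e12 : edge_of G h1 = edge_of G h2.
    by have := congr1 (@dip_edge m) E12; rewrite !dip_edge_half.
  have i12 : inc G h1 = inc G h2.
    by have := congr1 (@dip_inc m) E12; rewrite !dip_inc_half.
  have [h' _ [eh' i0 i1 hE]] := tail_head (edge_of G h2).
  have [h1E|h1E] := hE h1 e12; have [h2E|h2E] := hE h2 erefl.
  - exact: etrans h1E (esym h2E).
  - by move: i12; rewrite h1E i0 h2E i1.
  - by move: i12; rewrite h1E i1 h2E i0.
  - exact: etrans h1E (esym h2E).
have of_dipK : cancel of_dip to_dip.
  move=> k; rewrite /of_dip; case: pickP => [h /eqP //|none] /=.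
  by have [h hk] := to_dip_surj k; rewrite none in hk.
by exists of_dip => // h; apply: to_dip_inj; rewrite of_dipK.
Qed.

Definition dip_iso : giso G (dipole_graph m).
Proof.
apply: (@GIso _ _ _ _ _ _ G (dipole_graph m) id id to_dip).
- by exists id.
- by exists id.
- exact: to_dip_bij.
- by move=> h; rewrite /= dip_edge_half.
- by move=> h; rewrite /= dip_inc_half.
Defined.

Lemma dip_iso_push (o : orientation G) (o' : orientation (dipole_graph m)) :
  o' 1%g (dipole_dir m) = o 1%g d -> is_push dip_iso o o'.
Proof.
move=> oo' s s' d1 d1' sE dE.
have ss' : s' = s.
  by apply/permP => v; apply: enum_rank_inj; apply/val_inj; exact: sE.
rewrite (ori_change o' 1%g s' (dipole_dir m) d1') (ori_change o 1%g s d d1) oo' ss'.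
congr (_ ^+ (_ + _) * _); apply: eq_card => e; rewrite !inE dE.
have -> : dipole_dir m e = to_dip (d e).
  by have [h' _ [_ i0 _ _]] := tail_head e; rewrite /to_dip i0 tailP.
by rewrite (inj_eq (bij_inj to_dip_bij)).
Qed.
End ToDipole.

(** A nonzero sign excludes self-loops. Once all edges are directed from 0 to 1 the graph is a
    dipole, and the coordinate of [o] is the sign. *)
Lemma gc_class_dipole (m nh : nat) (G : hgraph 'I_2 'I_m 'I_nh) conn val
    (o : orientation G) (m_ge3 : (2 < m)%N) d : odd m -> graph_sign o 1%g d != 0 ->
  card_aut G = card_aut (dipole_graph m) /\
  (gc_class (OGraph conn val o) = gc_class (dipole m_ge3) /\ graph_sign o 1%g d = 1 \/
   gc_class (OGraph conn val o) = - gc_class (dipole m_ge3) /\ graph_sign o 1%g d = -1).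
Proof.
move=> m_odd gs0; have c2 := card_ord 2.
have cross e : crossing 1%g d e != 0.
  by apply: contraNneq gs0 => c0; rewrite /graph_sign (bigD1 e) //= c0 mul0r mulr0.
have [d' d'E] := directed_crossing c2 cross; pose phi := dip_iso d'E.
split; first exact: card_aut_iso phi.
have -> : graph_sign o 1%g d = o 1%g d'.
  rewrite -(graph_sign_indep c2 o 1%g 1%g d d') ?card_ord // /graph_sign.
  by rewrite big1 ?mulr1 // => e _; rewrite d'E.
have std1 : ograph_ori (dipole m_ge3) 1%g (dipole_dir m) = 1.
  rewrite [LHS]/(std_ori _ _ _ _) /std_ori odd_perm1 /flips.
  rewrite (_ : [set e | _] = finset.set0) ?cards0 //.
  by apply/setP => e; rewrite !inE eqxx.
have : (o 1%g d' == 1) || (o 1%g d' == -1).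
  by rewrite -eqf_sqr expr1n expr2 ori_unit.
case/orP => /eqP o1; [left|right]; split=> //.
  by apply: (@gc_class_iso (OGraph conn val o) (dipole m_ge3) phi); apply: dip_iso_push; rewrite o1.
rewrite -gc_class_opp; apply: (@gc_class_iso (OGraph conn val o) (opp_ograph (dipole m_ge3)) phi).
by apply: dip_iso_push; rewrite o1 -std1.
Qed.

(** * The pairing with the sum of dipoles *)

Section LinearExtension.
Variables (f : ograph -> rat) (fc : gc_compat f).

Lemma gc_ext0 : gc_ext f 0 = 0.
Proof. by have := gc_ext_linear fc (-1) 0 0; rewrite scaler0 addr0 mulN1r addNr. Qed.

Lemma gc_extD : {morph gc_ext f : X Y / X + Y}.
Proof. by move=> X Y; rewrite -{1}[X]scale1r (gc_ext_linear fc) mul1r. Qed.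

Lemma gc_extZ q X : gc_ext f (q *: X) = q * gc_ext f X.
Proof. by rewrite -[q *: X]addr0 (gc_ext_linear fc) gc_ext0 addr0. Qed.

Lemma gc_extN X : gc_ext f (- X) = - gc_ext f X.
Proof. by rewrite -scaleN1r gc_extZ mulN1r. Qed.
End LinearExtension.

(** If the sign is 0, the sign form separates the class of [g] from plus or minus the dipole;
    otherwise the pairing is the sign times the number of automorphisms. *)
Lemma gen_pairing_dipole g j : nv g = 2%N -> ne g = (j.+1.*2).+1 ->
  gen_pairing g (dipole (odd_ge3 j)) = (2 * ((j.+1.*2).+1)`!)%:R * ograph_sign g.
Proof.
move=> g2 gm; have m_odd : odd (j.+1.*2).+1 by rewrite /= odd_double.
rewrite /gen_pairing (negPf (gc_class_dipole_neq0 _ m_odd)).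
have sD := ograph_sign_dipole (odd_ge3 j) m_odd.
have ext g' : gc_ext ograph_sign (gc_class g') = ograph_sign g' := gc_extP ograph_sign_compat g'.
have [g0|g0] := eqVneq (ograph_sign g) 0.
  rewrite g0 mulr0 !ifN //; apply/eqP => gD; have := ext g; rewrite gD ?(gc_extN ograph_sign_compat) ext sD g0.
    by move/eqP; rewrite oppr_eq0 oner_eq0.
  by move/eqP; rewrite oner_eq0.
move: g0 {ext}; rewrite (ograph_signE 1%g (some_dir (ugraph g))) // ?gm // intr_eq0.
case: g g2 gm => n e h G conn val o /= n2 em; subst n e => gs0.
have [cA [[-> ->]|[-> ->]]] := gc_class_dipole conn val (odd_ge3 j) m_odd gs0.
  by rewrite eqxx cA card_aut_dipole mulr1.
rewrite eqxx ifN ?cA ?card_aut_dipole ?mulrN1 //.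
by apply/eqP => /esym /gc_opp_eq; apply/eqP/gc_class_dipole_neq0.
Qed.

Lemma card_halves (V E H : finType) (G : hgraph V E H) : #|H| = (2 * #|E|)%N.
Proof.
rewrite -sum1_card (partition_big (edge_of G) xpredT) //=.
rewrite (eq_bigr (fun=> 2%N)) ?sum_nat_const 1?mulnC // => e _.
by rewrite sum1_card; apply: etrans (edge_of_card G e); apply: eq_card => h; rewrite inE.
Qed.

Lemma valency_edges (V E H : finType) (G : hgraph V E H) :
  valency_ge3 G -> (3 * #|V| <= 2 * #|E|)%N.
Proof.
move=> /forallP val; rewrite -(card_halves G) -[X in (_ <= X)%N]sum1_card.
rewrite (partition_big (inc G) xpredT) //= mulnC -sum_nat_const; apply: leq_sum => v _.
by rewrite sum1_card (leq_trans (val v)) // /valency; apply/eq_leq/eq_card => h; rewrite inE.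
Qed.

Lemma mm_bidegree_eq j g : mm_bidegree j = bidegree g ->
  nv g = 2%N /\ ne g = (j.+1.*2).+1.
Proof.
rewrite mm_bidegreeE /bidegree /loops; move: (nv g) (ne g) => n m -[lE eE].
have mE : m%:Z = j.+1.*2%:Z + 1 by rewrite -lE in eE; move: eE; rewrite -mul2n; lia.
split; last by move: mE; lia.
by move: lE; rewrite mE; lia.
Qed.

(** The bidegree determines the numbers of vertices and edges, so at most one dipole meets [g], and
    its coefficient cancels the number of automorphisms. *)
Lemma graph_pairing_mm g : graph_pairing mm g = ograph_sign g.
Proof.
rewrite /graph_pairing [gc_comp _ _]/(mm_comp _) /mm_comp.
have pc := gen_pairing_compatr g.
rewrite (big_morph _ (gc_extD pc) (gc_ext0 pc)).
under eq_bigr => j _ do rewrite (gc_extZ pc) (gc_extP pc).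
have [/andP[/eqP g2 g_odd]|ng] := boolP ((nv g == 2%N) && odd (ne g)); last first.
  rewrite /ograph_sign (negPf ng) big1 // => j /eqP /mm_bidegree_eq[g2 gm].
  by case/negP: ng; rewrite g2 gm /= odd_double.
(* The valency condition rules out a single edge, for which the series has no term. *)
have g3 : (3 <= ne g)%N.
  by have := valency_edges (ograph_valency g); rewrite !card_ord g2; lia.
pose j := (ne g)./2.-1; have eE : ne g = (j.+1.*2).+1.
  by rewrite -[LHS]odd_double_half g_odd /j; lia.
have bE i : (mm_bidegree i == bidegree g) = (i == j).
  apply/eqP/eqP => [|->]; rewrite mm_bidegreeE /bidegree /loops g2 eE.
    by case; lia.
  by congr pair; lia.
have jlt : (j < `|(bidegree g).1|)%N by apply: mm_comp_bound; apply/eqP; rewrite bE.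
rewrite (big_pred1 (Ordinal jlt)) ; last by move=> i; rewrite bE.
rewrite (gen_pairing_dipole g2 eE) mulKf // pnatr_eq0 -lt0n muln_gt0 fact_gt0 //.
Qed.

Theorem corollary6p3 (R : realType) :
  (forall (V E H : finType) (G : hgraph V E H), gconnected G ->
     forall o : orientation G, graph_integral_convergent R o) /\
  (exists I : GC3 -> R,
     [/\ forall (q : rat) (X Y : GC3), I (q *: X + Y) = ratr q * I X + I Y,
         forall g : ograph, is_graph_integral (ograph_ori g) (I (gc_class g)) &
         forall X : GC3, I X = ratr (gc_pairing X mm)]).
Proof.
split=> [V E H G conn o|].
  split=> [|p]; first exact: presentation_exists (some_dir G) conn.
  have [V2|V2] := eqVneq #|V| 2%N; first exact: (presentation_rank1 R p o V2).1.
  exact/simplex_convergent_other/eqP.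
(* The pairing itself is taken as the linear form; it remains to identify it with the integral on
   oriented graphs. *)
exists (fun X => ratr (gc_pairing X mm)); split=> // [q X Y|g].
  by rewrite gc_pairing_linear rmorphD rmorphM.
split=> [|p]; first exact: presentation_exists (some_dir _) (ograph_connected g).
rewrite gc_pairing_class graph_pairing_mm.
have [g2|g2] := eqVneq (nv g) 2%N; last first.
  rewrite presented_integral_other ?card_ord; last exact/eqP.
  by rewrite /ograph_sign (negPf g2) /= rmorph0.
rewrite (presentation_rank1 R p _ _).2 ?card_ord //.
case: ifPn => g_odd; first by rewrite (ograph_signE (p_order p) (p_dir p)) // ratr_int.
by rewrite /ograph_sign (negPf g_odd) andbF rmorph0.
Qed.
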